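(* Let $d,n$ be positive integers and let $\mu\in{\rm Comp}_d(n)$. The linear map $\overline{\psi}_\mu:E_\mu{\rm CTL}_{d,n}(q)\to{\rm Mat}_{m_\mu}({\rm TL}_{\mu_1}(q)\otimes\mathcal{H}^{(\mu_2,\ldots,\mu_d)}(q))$ is an isomorphism of $\mathbb{C}[q,q^{-1}]$-algebras with inverse map $\overline{\phi}_\mu$. As a consequence, the map $$\overline{\psi}_n:=\bigoplus_{\mu\in{\rm Comp}_d(n)}\overline{\psi}_\mu:{\rm CTL}_{d,n}(q)\to\bigoplus_{\mu\in{\rm Comp}_d(n)}{\rm Mat}_{m_\mu}({\rm TL}_{\mu_1}(q)\otimes\mathcal{H}^{(\mu_2,\ldots,\mu_d)}(q))$$ is also an isomorphism of $\mathbb{C}[q,q^{-1}]$-algebras, with inverse map $$\overline{\phi}_n:=\bigoplus_{\mu\in{\rm Comp}_d(n)}\overline{\phi}_\mu:\bigoplus_{\mu\in{\rm Comp}_d(n)}{\rm Mat}_{m_\mu}({\rm TL}_{\mu_1}(q)\otimes\mathcal{H}^{(\mu_2,\ldots,\mu_d)}(q))\to{\rm CTL}_{d,n}(q).$$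
   Context: Let $q$ be an indeterminate. The Yokonuma--Hecke algebra ${\rm Y}_{d,n}(q)$ is the associative unital $\mathbb{C}[q,q^{-1}]$-algebra generated by $g_1,\dots,g_{n-1},t_1,\dots,t_n$ with relations: $g_ig_j=g_jg_i$ if $|i-j|>1$; $g_ig_{i+1}g_i=g_{i+1}g_ig_{i+1}$ for $1\le i\le n-2$; $t_it_j=t_jt_i$; $t_jg_i=g_it_{s_i(j)}$ where $s_i=(i,i+1)\in\mathfrak{S}_n$; $t_j^d=1$; and $g_i^2=q+(q-1)e_ig_i$, where $e_i=\frac1d\sum_{s=0}^{d-1}t_i^st_{i+1}^{-s}$. For $w\in\mathfrak{S}_n$ with reduced expression $s_{i_1}\cdots s_{i_r}$, $g_w:=g_{i_1}\cdots g_{i_r}$. Let $\ell$ be the length function on $\mathfrak{S}_n$. Complex Reflection Temperley--Lieb algebra: ${\rm CTL}_{d,n}(q)={\rm Y}_{d,n}(q)/\mathfrak{I}_{d,n}$, where $\mathfrak{I}_{d,n}$ is the two-sided ideal generated by $T_1e_1e_2\,g_{1,2}$ with $T_1=\frac1d\sum_{s=0}^{d-1}t_1^s$ and $g_{1,2}=1+g_1+g_2+g_1g_2+g_2g_1+g_1g_2g_1$ (and $\mathfrak{I}_{d,n}=\{0\}$ if $n\le2$). The Iwahori--Hecke algebra $\mathcal{H}_n(q)$ is the $\mathbb{C}[q,q^{-1}]$-algebra generated by $G_1,\dots,G_{n-1}$ with the braid relations $G_iG_j=G_jG_i$ ($|i-j|>1$), $G_iG_{i+1}G_i=G_{i+1}G_iG_{i+1}$,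 and $G_i^2=q+(q-1)G_i$; it is free with basis $G_w:=G_{i_1}\cdots G_{i_r}$, $w\in\mathfrak{S}_n$ ($\mathcal{H}_0(q)=\mathcal{H}_1(q)=\mathbb{C}[q,q^{-1}]$). The Temperley--Lieb algebra is ${\rm TL}_n(q)=\mathcal{H}_n(q)/I_n$, with $I_n$ the two-sided ideal generated by $G_{1,2}:=1+G_1+G_2+G_1G_2+G_2G_1+G_1G_2G_1$ if $n\ge3$ and $I_n=\{0\}$ if $n\le2$. ${\rm Comp}_d(n)$ is the set of $d$-tuples $\mu=(\mu_1,\dots,\mu_d)$ of non-negative integers with sum $n$. For such $\mu$, let $\mathfrak{S}_\mu=\mathfrak{S}_{\mu_1}\times\cdots\times\mathfrak{S}_{\mu_d}\subseteq\mathfrak{S}_n$ be the Young subgroup (acting on consecutive blocks), generated by the $s_j$ with $j\in J^\mu:=\{1,\dots,n-1\}\setminus\{\mu_1,\mu_1+\mu_2,\dots,\mu_1+\cdots+\mu_{d-1}\}$. $\mathcal{H}^\mu(q)\cong\mathcal{H}_{\mu_1}(q)\otimes\cdots\otimes\mathcal{H}_{\mu_d}(q)$ (tensor products over $\mathbb{C}[q,q^{-1}]$) is the subalgebra of $\mathcal{H}_n(q)$ generated by $\{G_j\mid j\in J^\mu\}$, with basis $\{G_w\mid w\in\mathfrak{S}_\mu\}$. $\mathcal{H}^{(\mu_2,\dots,\mu_d)}(q):=\mathcal{H}_{\mu_2}(q)\otimes\cdots\otimes\mathcal{H}_{\mu_d}(q)$. Let ${\rm P}_1:\mathcal{H}^\mu(q)\twoheadrightarrow{\rm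 TL}_{\mu_1}(q)\otimes\mathcal{H}^{(\mu_2,\dots,\mu_d)}(q)$ be the tensor product of the natural surjection $\mathcal{H}_{\mu_1}(q)\twoheadrightarrow{\rm TL}_{\mu_1}(q)$ with the identity; the induced (entrywise) map on $m_\mu\times m_\mu$ matrices is also denoted ${\rm P}_1$. Let $\{\xi_1,\dots,\xi_d\}$ be the $d$-th roots of unity in $\mathbb{C}$, ordered so that $\xi_1=1$, and $\mathcal{A}_{d,n}\cong(\mathbb{Z}/d\mathbb{Z})^n$ the group generated by $t_1,\dots,t_n$. For an irreducible character $\chi$ of $\mathcal{A}_{d,n}$ let $E_\chi:=\prod_{j=1}^n\bigl(\frac1d\sum_{s=0}^{d-1}\chi(t_j)^st_j^{-s}\bigr)$. $\mathfrak{S}_n$ acts on characters by $w(\chi)(t_j)=\chi(t_{w^{-1}(j)})$. Let $\chi_1^\mu$ be the character with $\chi_1^\mu(t_j)=\xi_i$ for $\mu_1+\cdots+\mu_{i-1}<j\le\mu_1+\cdots+\mu_i$. Let $\pi_{\mu,1}=1,\dots,\pi_{\mu,m_\mu}$, $m_\mu=\frac{n!}{\mu_1!\cdots\mu_d!}$, be the minimal length representatives of the left cosets $\mathfrak{S}_n/\mathfrak{S}_\mu$, and $\chi_k^\mu:=\pi_{\mu,k}(\chi_1^\mu)$. Put $E_\mu:=\sum_{k=1}^{m_\mu}E_{\chi_k^\mu}$. The $E_\mu$ form a complete set of central orthogonal idempotents of ${\rm Y}_{d,n}(q)$; the image of $E_\mu$ in ${\rm CTL}_{d,n}(q)$ is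 also written $E_\mu$, so ${\rm CTL}_{d,n}(q)=\bigoplus_\mu E_\mu{\rm CTL}_{d,n}(q)$ and $E_\mu{\rm CTL}_{d,n}(q)\cong E_\mu{\rm Y}_{d,n}(q)/E_\mu\mathfrak{I}_{d,n}$. Let $\Theta^\mu:E_\mu{\rm Y}_{d,n}(q)\twoheadrightarrow E_\mu{\rm CTL}_{d,n}(q)$ be the natural surjection. Let $M_{k,l}$ be the elementary $m_\mu\times m_\mu$ matrices and $U_\mu:=\sum_kq^{\ell(\pi_{\mu,k})/2}M_{k,k}$. Over $\mathbb{C}[q^{1/2},q^{-1/2}]$ define the linear map $\widetilde{\Psi}_\mu(E_{\chi_k^\mu}g_w):=q^{\frac12(\ell(w)-\ell(\pi_{\mu,k}^{-1}w\pi_{\mu,l}))}G_{\pi_{\mu,k}^{-1}w\pi_{\mu,l}}M_{k,l}$, where $l$ is determined by $w(\chi_l^\mu)=\chi_k^\mu$. The map $\Psi_\mu:E_\mu{\rm Y}_{d,n}(q)\to{\rm Mat}_{m_\mu}(\mathcal{H}^\mu(q))$, $\Psi_\mu(E_\mu a)=U_\mu\widetilde{\Psi}_\mu(E_\mu a)U_\mu^{-1}$, is an isomorphism of $\mathbb{C}[q,q^{-1}]$-algebras; let $\Phi_\mu$ be its inverse. $\overline{\psi}_\mu:E_\mu{\rm CTL}_{d,n}(q)\to{\rm Mat}_{m_\mu}({\rm TL}_{\mu_1}(q)\otimes\mathcal{H}^{(\mu_2,\dots,\mu_d)}(q))$ is the unique $\mathbb{C}[q,q^{-1}]$-algebra homomorphism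 with $\overline{\psi}_\mu\circ\Theta^\mu={\rm P}_1\circ\Psi_\mu$, and $\overline{\phi}_\mu$, in the opposite direction, is the unique $\mathbb{C}[q,q^{-1}]$-algebra homomorphism with $\overline{\phi}_\mu\circ{\rm P}_1=\Theta^\mu\circ\Phi_\mu$ (both exist). *)

(* Defs.v *)
From HB Require Import structures.
From mathcomp Require Import all_boot all_order all_algebra all_fingroup.
From mathcomp Require Import finmap.
From mathcomp Require Import boolp classical_sets reals complex.
From mathcomp.multinomials Require Import monalg.

Set Implicit Arguments.
Unset Strict Implicit.
Unset Printing Implicit Defensive.

Import GRing.Theory Num.Theory.
Local Open Scope ring_scope.
Local Open Scope quotient_scope.

(* The library's [algType] requires 1 <> 0, which is not available a priori for
   algebras given by generators and relations; here an R-algebra is a unital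
   ring with a ring morphism from R to its centre. *)
Record algebra (R : comNzRingType) := Algebra {
  alg_ring :> pzRingType;
  alg_in : {rmorphism R -> alg_ring};
  alg_inC : forall a x, alg_in a * x = x * alg_in a
}.

Definition ascale (R : comNzRingType) (A : algebra R) (a : R) (x : A) : A :=
  alg_in A a * x.

Notation "a *^ x" := (ascale a x) (at level 40, left associativity) : ring_scope.

(* Operations of an algebra, without the axioms: this is what is needed to speak
   of morphisms to and from the summands E A, whose unit is E. *)
Record algops (R : Type) := AlgOps {
  ops_car :> Type;
  op_add : ops_car -> ops_car -> ops_car;
  op_mul : ops_car -> ops_car -> ops_car;
  op_one : ops_car;
  op_scale : R -> ops_car -> ops_car
}.

Definition ops (R : comNzRingType) (A : algebra R) : algops R :=
  @AlgOps R A +%R *%R 1 (@ascale R A).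

Definition linear_map (R : Type) (A B : algops R) (f : A -> B) : Prop :=
  {morph f : x y / op_add x y} /\ forall a, {morph f : x / op_scale a x}.

Definition alg_hom (R : Type) (A B : algops R) (f : A -> B) : Prop :=
  [/\ linear_map f, {morph f : x y / op_mul x y} & f (op_one A) = op_one B].

Definition alg_iso (R : Type) (A B : algops R) (f : A -> B) : Prop :=
  alg_hom f /\ bijective f.

Section BaseAlgebra.
Variable R : comNzRingType.

Fact base_alg_inC (a x : R) : idfun a * x = x * idfun a.
Proof. exact: mulrC. Qed.

Definition base_alg : algebra R := @Algebra R R idfun base_alg_inC.
End BaseAlgebra.

(******************************************************************************)

(* The right ideal e A with the operations of A and unit e; it is an algebra when e
   is a central idempotent. *)
Section Corner.
Variables (R : comNzRingType) (A : algebra R) (e : A).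

Definition corner_set : set A := [set x | exists a, x = e * a]%classic.

Definition in_corner (x : A) : bool := `[< corner_set x >].

Definition corner : Type := {x : A | in_corner x}.

Fact corner_in_proof (x : A) : in_corner (e * x).
Proof. by apply/asboolP; exists x. Qed.

Definition corner_in (x : A) : corner := exist in_corner (e * x) (corner_in_proof x).

Fact corner_add_proof (x y : corner) : in_corner (val x + val y).
Proof.
have /asboolP[a ->] := valP x; have /asboolP[b ->] := valP y.
by apply/asboolP; exists (a + b); rewrite mulrDr.
Qed.

Fact corner_mul_proof (x y : corner) : in_corner (val x * val y).
Proof.
have /asboolP[a ->] := valP x; have /asboolP[b ->] := valP y.
by apply/asboolP; exists (a * (e * b)); rewrite !mulrA.
Qed.

Fact corner_one_proof : in_corner e.
Proof. by apply/asboolP; exists 1; rewrite mulr1. Qed.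

Fact corner_scale_proof (a : R) (x : corner) : in_corner (a *^ val x).
Proof.
have /asboolP[b ->] := valP x; apply/asboolP; exists (a *^ b).
by rewrite /ascale !mulrA alg_inC.
Qed.

Definition corner_ops : algops R := @AlgOps R corner
  (fun x y => exist in_corner _ (corner_add_proof x y))
  (fun x y => exist in_corner _ (corner_mul_proof x y))
  (exist in_corner _ corner_one_proof)
  (fun a x => exist in_corner _ (corner_scale_proof a x)).

End Corner.

(******************************************************************************)

Section MatrixAlgebra.
Variables (R : comNzRingType) (A : algebra R) (m : nat).

Definition mat_in (a : R) : 'M[A]_m := (alg_in A a)%:M.

Fact mat_in_zmod : zmod_morphism mat_in.
Proof. by move=> a b; rewrite /mat_in rmorphB raddfB. Qed.
Fact mat_in_monoid : monoid_morphism mat_in.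
Proof. by split=> [|a b]; rewrite /mat_in ?rmorph1 // rmorphM scalar_mxM. Qed.
HB.instance Definition _ :=
  GRing.isZmodMorphism.Build R 'M[A]_m mat_in mat_in_zmod.
HB.instance Definition _ :=
  GRing.isMonoidMorphism.Build R 'M[A]_m mat_in mat_in_monoid.

Fact mat_inC a (M : 'M[A]_m) : mat_in a * M = M * mat_in a.
Proof.
change (mat_in a *m M = M *m mat_in a); apply/matrixP => i j.
rewrite mul_scalar_mx !mxE (bigD1 j) //= big1 => [|k kj]; rewrite !mxE.
  by rewrite eqxx addr0 alg_inC.
by rewrite (negbTE kj) mulr0.
Qed.

Definition mat_alg : algebra R := @Algebra R 'M[A]_m mat_in mat_inC.

End MatrixAlgebra.

(******************************************************************************)

Section ProductAlgebra.
Variables (R : comNzRingType) (I : Type) (F : I -> algebra R).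

Definition prod_car : Type := forall i, F i.
HB.instance Definition _ := gen_eqMixin prod_car.
HB.instance Definition _ := gen_choiceMixin prod_car.

Let padd (x y : prod_car) : prod_car := fun i => x i + y i.
Let popp (x : prod_car) : prod_car := fun i => - x i.
Let pmul (x y : prod_car) : prod_car := fun i => x i * y i.

Fact paddA : associative padd.
Proof. by move=> x y z; apply: functional_extensionality_dep => i; exact: addrA. Qed.
Fact paddC : commutative padd.
Proof. by move=> x y; apply: functional_extensionality_dep => i; exact: addrC. Qed.
Fact padd0 : left_id (fun i => 0) padd.
Proof. by move=> x; apply: functional_extensionality_dep => i; exact: add0r. Qed.
Fact paddN : left_inverse (fun i => 0) popp padd.
Proof. by move=> x; apply: functional_extensionality_dep => i; exact: addNr. Qed.
HB.instance Definition _ :=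
  GRing.isZmodule.Build prod_car paddA paddC padd0 paddN.

Fact pmulA : associative pmul.
Proof. by move=> x y z; apply: functional_extensionality_dep => i; exact: mulrA. Qed.
Fact pmul1 : left_id (fun i => 1) pmul.
Proof. by move=> x; apply: functional_extensionality_dep => i; exact: mul1r. Qed.
Fact p1mul : right_id (fun i => 1) pmul.
Proof. by move=> x; apply: functional_extensionality_dep => i; exact: mulr1. Qed.
Fact pmulDl : left_distributive pmul padd.
Proof. by move=> x y z; apply: functional_extensionality_dep => i; exact: mulrDl. Qed.
Fact pmulDr : right_distributive pmul padd.
Proof. by move=> x y z; apply: functional_extensionality_dep => i; exact: mulrDr. Qed.
HB.instance Definition _ := GRing.Zmodule_isPzRing.Build prod_car
  pmulA pmul1 p1mul pmulDl pmulDr.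

Definition prod_in (a : R) : prod_car := fun i => alg_in (F i) a.

Fact prod_in_zmod : zmod_morphism prod_in.
Proof. by move=> a b; apply: functional_extensionality_dep => i; exact: rmorphB. Qed.
Fact prod_in_monoid : monoid_morphism prod_in.
Proof.
by split=> [|a b]; apply: functional_extensionality_dep => i;
  rewrite /prod_in ?rmorph1 ?rmorphM.
Qed.
HB.instance Definition _ :=
  GRing.isZmodMorphism.Build R prod_car prod_in prod_in_zmod.
HB.instance Definition _ :=
  GRing.isMonoidMorphism.Build R prod_car prod_in prod_in_monoid.

Fact prod_inC a (x : prod_car) : prod_in a * x = x * prod_in a.
Proof. by apply: functional_extensionality_dep => i; exact: alg_inC. Qed.

Definition prod_alg : algebra R := @Algebra R prod_car prod_in prod_inC.

End ProductAlgebra.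

(******************************************************************************)

Section Ideal.
Variable A : pzRingType.
Local Open Scope classical_set_scope.

Definition two_sided_ideal (I : set A) : Prop :=
  [/\ I 0, forall x y, I x -> I y -> I (x + y)
    & forall a x b, I x -> I (a * x * b)].

Definition ideal_gen (S : set A) : set A :=
  [set x | forall I, two_sided_ideal I -> S `<=` I -> I x].

Lemma ideal_genP S : two_sided_ideal (ideal_gen S).
Proof.
split=> [I [] //|x y Sx Sy I idI SI|a x b Sx I idI SI]; case: (idI) => I0 ID IM.
  by apply: ID; [exact: Sx|exact: Sy].
by apply: IM; exact: Sx.
Qed.

Lemma sub_ideal_gen S : S `<=` ideal_gen S.
Proof. by move=> x Sx I _; apply. Qed.

End Ideal.

Section Quotient.
Variables (R : comNzRingType) (A : algebra R) (S : set A).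

Let I := ideal_gen S.
Let I0 : I 0. Proof. by have [] := ideal_genP S. Qed.
Let ID x y : I x -> I y -> I (x + y).
Proof. by have [_ + _] := ideal_genP S; apply. Qed.
Let IM a x b : I x -> I (a * x * b).
Proof. by have [_ _] := ideal_genP S; apply. Qed.
Let IMl a x : I x -> I (a * x). Proof. by move/(IM a 1); rewrite mulr1. Qed.
Let IMr x b : I x -> I (x * b). Proof. by move/(IM 1 b); rewrite mul1r. Qed.
Let IN x : I x -> I (- x). Proof. by move/(IMl (-1)); rewrite mulN1r. Qed.

Definition quot_rel (x y : A) : bool := `[< I (x - y) >].

Fact quot_rel_equiv : equiv_class_of quot_rel.
Proof.
split=> [x|x y|y x z]; first by apply/asboolP; rewrite subrr.
- by apply/asboolP/asboolP => /IN; rewrite opprB.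
- move=> /asboolP xy /asboolP yz; apply/asboolP.
  by rewrite -[x](addrNK y) -addrA; exact: ID.
Qed.

Canonical quot_equiv := EquivRelPack quot_rel_equiv.
Canonical quot_encModRel := defaultEncModRel quot_rel.

Definition quot_car := {eq_quot quot_rel}.
HB.instance Definition _ : EqQuotient A quot_rel quot_car :=
  EqQuotient.on quot_car.
HB.instance Definition _ := Choice.on quot_car.

Definition quot_pi (x : A) : quot_car := \pi_quot_car x.

Lemma quot_piP x y : quot_pi x = quot_pi y <-> I (x - y).
Proof.
split=> [/eqP|Ixy]; first by rewrite /quot_pi piE => /asboolP.
by apply/eqP; rewrite /quot_pi piE; apply/asboolP.
Qed.

Let rep (x : quot_car) : A := generic_quotient.repr x.
Let repK x : quot_pi (rep x) = x. Proof. exact: reprK. Qed.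
Let repI x : I (rep (quot_pi x) - x). Proof. by apply/quot_piP; rewrite repK. Qed.

Definition quot_add (x y : quot_car) := quot_pi (rep x + rep y).
Definition quot_opp (x : quot_car) := quot_pi (- rep x).
Definition quot_mul (x y : quot_car) := quot_pi (rep x * rep y).

Fact quot_addE x y : quot_add (quot_pi x) (quot_pi y) = quot_pi (x + y).
Proof. by apply/quot_piP; rewrite opprD addrACA; apply: ID; exact: repI. Qed.
Fact quot_oppE x : quot_opp (quot_pi x) = quot_pi (- x).
Proof. by apply/quot_piP; rewrite -opprD; apply: IN; exact: repI. Qed.
Fact quot_mulE x y : quot_mul (quot_pi x) (quot_pi y) = quot_pi (x * y).
Proof.
apply/quot_piP; set u := rep _; set v := rep _.
have -> : u * v - x * y = (u - x) * v + x * (v - y).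
  by rewrite mulrBl mulrBr addrA subrK.
by apply: ID; [apply: IMr|apply: IMl]; exact: repI.
Qed.

Fact quot_addA : associative quot_add.
Proof. by move=> x y z; rewrite -[x]repK -[y]repK -[z]repK !quot_addE addrA. Qed.
Fact quot_addC : commutative quot_add.
Proof. by move=> x y; rewrite -[x]repK -[y]repK !quot_addE addrC. Qed.
Fact quot_add0 : left_id (quot_pi 0) quot_add.
Proof. by move=> x; rewrite -[x]repK quot_addE add0r. Qed.
Fact quot_addN : left_inverse (quot_pi 0) quot_opp quot_add.
Proof. by move=> x; rewrite -[x]repK quot_oppE quot_addE addNr. Qed.
HB.instance Definition _ :=
  GRing.isZmodule.Build quot_car quot_addA quot_addC quot_add0 quot_addN.

Fact quot_mulA : associative quot_mul.
Proof. by move=> x y z; rewrite -[x]repK -[y]repK -[z]repK !quot_mulE mulrA. Qed.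
Fact quot_mul1l : left_id (quot_pi 1) quot_mul.
Proof. by move=> x; rewrite -[x]repK quot_mulE mul1r. Qed.
Fact quot_mul1r : right_id (quot_pi 1) quot_mul.
Proof. by move=> x; rewrite -[x]repK quot_mulE mulr1. Qed.
Fact quot_mulDl : left_distributive quot_mul quot_add.
Proof.
move=> x y z; rewrite -[x]repK -[y]repK -[z]repK.
by rewrite !(quot_addE, quot_mulE) mulrDl.
Qed.
Fact quot_mulDr : right_distributive quot_mul quot_add.
Proof.
move=> x y z; rewrite -[x]repK -[y]repK -[z]repK.
by rewrite !(quot_addE, quot_mulE) mulrDr.
Qed.
HB.instance Definition _ := GRing.Zmodule_isPzRing.Build quot_car
  quot_mulA quot_mul1l quot_mul1r quot_mulDl quot_mulDr.

Fact quot_pi_zmod : zmod_morphism quot_pi.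
Proof. by move=> x y; rewrite -quot_addE -quot_oppE. Qed.
Fact quot_pi_monoid : monoid_morphism quot_pi.
Proof. by split=> // x y; rewrite -quot_mulE. Qed.
HB.instance Definition _ :=
  GRing.isZmodMorphism.Build A quot_car quot_pi quot_pi_zmod.
HB.instance Definition _ :=
  GRing.isMonoidMorphism.Build A quot_car quot_pi quot_pi_monoid.

Fact quot_inC a (x : quot_car) :
  (quot_pi \o alg_in A) a * x = x * (quot_pi \o alg_in A) a.
Proof. by rewrite -[x]repK /= -!rmorphM /= alg_inC. Qed.

Definition quot_alg : algebra R :=
  @Algebra R quot_car (quot_pi \o alg_in A) quot_inC.

Definition quot_proj : A -> quot_alg := quot_pi.

Lemma quot_proj_hom : @alg_hom R (ops A) (ops quot_alg) quot_proj.
Proof.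
split; first split=> [x y|a x]; rewrite /quot_proj /=.
- exact: rmorphD.
- by rewrite /ascale rmorphM.
- by move=> x y /=; exact: rmorphM.
- exact: rmorph1.
Qed.

Lemma quot_projP x y : quot_proj x = quot_proj y <-> I (x - y).
Proof. exact: quot_piP. Qed.

Lemma quot_proj_eq x y : S (x - y) -> quot_proj x = quot_proj y.
Proof. by move=> Sxy; apply/quot_projP; exact: sub_ideal_gen. Qed.

Lemma quot_projD x y : quot_proj (x + y) = quot_proj x + quot_proj y.
Proof. exact: (rmorphD quot_pi). Qed.
Lemma quot_projM x y : quot_proj (x * y) = quot_proj x * quot_proj y.
Proof. exact: (rmorphM quot_pi). Qed.
Lemma quot_projZ a x : quot_proj (a *^ x) = a *^ quot_proj x.
Proof. exact: quot_projM. Qed.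
Lemma quot_proj1 : quot_proj 1 = 1.
Proof. exact: (rmorph1 quot_pi). Qed.

Lemma quot_proj_surj (y : quot_alg) : exists x, quot_proj x = y.
Proof. by exists (rep y); exact: repK. Qed.

End Quotient.

(******************************************************************************)

Section Presented.
Variables (R : comNzRingType) (G : choiceType).

Fact free_inC (a : R) (x : {malg R[fmonom G]}) :
  @malgC (fmonom G) R a * x = x * @malgC (fmonom G) R a.
Proof.
rewrite !malgM_def fgmulUg fgmulgU.
by apply: eq_bigr => k _; rewrite mul1m mulm1 mulrC.
Qed.

Definition free_alg : algebra R :=
  @Algebra R {malg R[fmonom G]} (@malgC (fmonom G) R) free_inC.

Definition free_gen (g : G) : free_alg := << (1 : R) *g fmu g >>.

Definition presented (rel : set free_alg) : algebra R := quot_alg rel.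

Definition pres_gen (rel : set free_alg) (g : G) : presented rel :=
  quot_proj rel (free_gen g).

Section Eval.
Variables (B : algebra R) (f : G -> B).

Definition word_eval (w : seq G) : B := \prod_(g <- w) f g.

Definition free_eval (x : free_alg) : B :=
  \sum_(k <- msupp (x : {malg R[fmonom G]}))
     alg_in B (mcoeff k x) * word_eval k.

Lemma free_evalE (d : {fset fmonom G}) (x : free_alg) :
  (msupp (x : {malg R[fmonom G]}) `<=` d)%fset ->
  free_eval x = \sum_(k <- d) alg_in B (mcoeff k x) * word_eval k.
Proof.
move=> le; rewrite /free_eval (big_fset_incl _ le) //= => k _ /mcoeff_outdom ->.
by rewrite rmorph0 mul0r.
Qed.

Lemma free_evalU a k :
  free_eval (<< a *g k >> : {malg R[fmonom G]}) = alg_in B a * word_eval k.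
Proof. by rewrite (free_evalE msuppU_le) big_seq_fset1 mcoeffUU. Qed.

Fact free_eval_zmod : zmod_morphism free_eval.
Proof.
move=> x y /=; set d := (msupp (x : {malg R[fmonom G]}) `|` msupp (y : {malg R[fmonom G]}))%fset.
rewrite (@free_evalE d (x - y)) ?msuppB_le // (@free_evalE d x) ?fsubsetUl //.
rewrite (@free_evalE d y) ?fsubsetUr // -sumrB.
by apply: eq_bigr => k _; rewrite mcoeffB rmorphB mulrBl.
Qed.
HB.instance Definition _ :=
  GRing.isZmodMorphism.Build free_alg B free_eval free_eval_zmod.

Fact free_eval_monoid : monoid_morphism free_eval.
Proof.
split; first by rewrite [LHS]free_evalU rmorph1 mul1r /word_eval fm1 big_nil.
move=> x y; rewrite [x * y]malgME raddf_sum /free_eval mulr_suml.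
apply: eq_bigr => k _; rewrite raddf_sum mulr_sumr; apply: eq_bigr => l _ /=.
rewrite [LHS]free_evalU rmorphM /word_eval fmM big_cat /= !mulrA.
by congr (_ * _); rewrite -!mulrA; congr (_ * _); exact: alg_inC.
Qed.
HB.instance Definition _ :=
  GRing.isMonoidMorphism.Build free_alg B free_eval free_eval_monoid.

Lemma free_eval_gen g : free_eval (free_gen g) = f g.
Proof. by rewrite free_evalU rmorph1 mul1r /word_eval fmU big_seq1. Qed.

Lemma free_eval_in a : free_eval (alg_in free_alg a) = alg_in B a.
Proof. by rewrite free_evalU /word_eval fm1 big_nil mulr1. Qed.

Variable rel : set free_alg.

Definition pres_lift (x : presented rel) : B :=
  free_eval (@generic_quotient.repr _ (quot_car rel) x).

Hypothesis relf : forall x, rel x -> free_eval x = 0.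

Lemma pres_lift_proj (x : free_alg) : pres_lift (quot_proj rel x) = free_eval x.
Proof.
apply/eqP; rewrite -subr_eq0 -raddfB /=; apply/eqP.
have: quot_pi rel (@generic_quotient.repr _ (quot_car rel) (quot_proj rel x)) = quot_pi rel x.
  exact: reprK.
move/quot_piP/(_ [set y | free_eval y = 0]%classic); apply; last exact: relf.
split=> [|u v /= Iu Iv|a u b /= Iu]; first exact: raddf0.
  by rewrite raddfD /= Iu Iv addr0.
by rewrite !rmorphM /= Iu mulr0 mul0r.
Qed.

Lemma pres_lift_gen g : pres_lift (pres_gen rel g) = f g.
Proof. by rewrite pres_lift_proj free_eval_gen. Qed.

Lemma pres_lift_hom : @alg_hom R (ops (presented rel)) (ops B) pres_lift.
Proof.
have [_ pM p1] := quot_proj_hom rel.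
split; first split=> [x y|a x].
- have [u <-] := quot_proj_surj x; have [v <-] := quot_proj_surj y.
  by rewrite /= -[_ + _](raddfD (quot_pi rel)) !pres_lift_proj raddfD.
- have [u <-] := quot_proj_surj x.
  rewrite /= /ascale -[_ * _](rmorphM (quot_pi rel)) !pres_lift_proj rmorphM /=.
  by rewrite free_eval_in.
- move=> x y; have [u <-] := quot_proj_surj x; have [v <-] := quot_proj_surj y.
  by rewrite /= -[_ * _](rmorphM (quot_pi rel)) !pres_lift_proj rmorphM.
- by rewrite /= -[1](rmorph1 (quot_pi rel)) pres_lift_proj rmorph1.
Qed.

End Eval.
End Presented.

(******************************************************************************)

Section Tensor.
Variables (R : comNzRingType) (A B : algebra R).

Local Notation "x # y" := (@free_gen R (A * B)%type (x, y)) (at level 38).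

Inductive tens_rel : free_alg R (A * B)%type -> Prop :=
| tens_addl x x' y : tens_rel ((x + x') # y - (x # y + x' # y))
| tens_addr x y y' : tens_rel (x # (y + y') - (x # y + x # y'))
| tens_scalel a x y : tens_rel ((a *^ x) # y - a *^ (x # y))
| tens_scaler a x y : tens_rel (x # (a *^ y) - a *^ (x # y))
| tens_mul x y x' y' : tens_rel ((x # y) * (x' # y') - (x * x') # (y * y'))
| tens_one : tens_rel (1 # 1 - 1).

(* A (x) B: spanned by the pure tensors, with (x (x) y)(x' (x) y') =
   (x x') (x) (y y') and unit 1 (x) 1. *)
Definition tens : algebra R := presented (tens_rel : set _).

Definition tens_pure (x : A) (y : B) : tens :=
  @pres_gen R (A * B)%type (tens_rel : set _) (x, y).

Local Notation "x ⊗ y" := (tens_pure x y) (at level 38).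

Lemma tens_pureDl x x' y : (x + x') ⊗ y = x ⊗ y + x' ⊗ y.
Proof. by rewrite -quot_projD; apply: quot_proj_eq; exact: tens_addl. Qed.
Lemma tens_pureDr x y y' : x ⊗ (y + y') = x ⊗ y + x ⊗ y'.
Proof. by rewrite -quot_projD; apply: quot_proj_eq; exact: tens_addr. Qed.
Lemma tens_pureZl a x y : (a *^ x) ⊗ y = a *^ (x ⊗ y).
Proof. by rewrite -quot_projZ; apply: quot_proj_eq; exact: tens_scalel. Qed.
Lemma tens_pureZr a x y : x ⊗ (a *^ y) = a *^ (x ⊗ y).
Proof. by rewrite -quot_projZ; apply: quot_proj_eq; exact: tens_scaler. Qed.
Lemma tens_pureM x y x' y' : (x ⊗ y) * (x' ⊗ y') = (x * x') ⊗ (y * y').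
Proof. by rewrite -quot_projM; apply: quot_proj_eq; exact: tens_mul. Qed.
Lemma tens_pure1 : 1 ⊗ 1 = 1.
Proof. by rewrite -quot_proj1; apply: quot_proj_eq; exact: tens_one. Qed.

End Tensor.

Notation "x ⊗ y" := (tens_pure x y) (at level 38) : ring_scope.

Section TensorMap.
Variables (R : comNzRingType) (A A' B B' : algebra R) (f : A -> A') (g : B -> B').

Definition tens_map : tens A B -> tens A' B' :=
  @pres_lift R (A * B)%type (tens A' B') (fun u => f u.1 ⊗ g u.2)
    (@tens_rel R A B).

Hypothesis (fh : @alg_hom R (ops A) (ops A') f).
Hypothesis (gh : @alg_hom R (ops B) (ops B') g).

Let F (u : A * B) : tens A' B' := f u.1 ⊗ g u.2.

Fact tens_map_rel x : @tens_rel R A B x -> free_eval F x = 0.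
Proof.
have EB u v : free_eval F u = free_eval F v -> free_eval F (u - v) = 0.
  by move=> uv; rewrite raddfB /= uv subrr.
have ED u v : free_eval F (u + v) = free_eval F u + free_eval F v.
  exact: raddfD.
have EM u v : free_eval F (u * v) = free_eval F u * free_eval F v.
  exact: (rmorphM (free_eval F)).
have EZ a u : free_eval F (a *^ u) = a *^ free_eval F u.
  by rewrite EM free_eval_in.
have E1 : free_eval F 1 = 1 by exact: (rmorph1 (free_eval F)).
case: fh => -[/= fD fZ] fM f1; case: gh => -[/= gD gZ] gM g1.
have EG u : free_eval F (free_gen _ u) = F u by exact: free_eval_gen.
case=> [a a' b|a b b'|c a b|c a b|a b a' b'|]; apply: EB.
- by rewrite ED !EG /F /= fD tens_pureDl.
- by rewrite ED !EG /F /= gD tens_pureDr.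
- by rewrite EZ !EG /F /= fZ tens_pureZl.
- by rewrite EZ !EG /F /= gZ tens_pureZr.
- by rewrite EM !EG /F /= fM gM tens_pureM.
- by rewrite E1 EG /F /= f1 g1 tens_pure1.
Qed.

Lemma tens_mapE x y : tens_map (x ⊗ y) = f x ⊗ g y.
Proof. exact: (pres_lift_gen tens_map_rel). Qed.

Lemma tens_map_hom : @alg_hom R (ops (tens A B)) (ops (tens A' B')) tens_map.
Proof. exact: (pres_lift_hom tens_map_rel). Qed.

End TensorMap.

(******************************************************************************)

Section Laurent.
Variable F : realType.
Local Notation C := F[i].

(* C(q^(1/2)), where both C[q, q^-1] and C[q^(1/2), q^(-1/2)] live. *)
Definition ratfun : fieldType := {fraction {poly C}}.

Definition ratC (c : C) : ratfun := tofrac c%:P.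
HB.instance Definition _ :=
  GRing.RMorphism.copy ratC (@tofrac {poly C} \o @polyC C).

Definition sqrtq : ratfun := tofrac 'X.

Lemma sqrtq_neq0 : sqrtq != 0.
Proof. by rewrite tofrac_eq0 polyX_eq0. Qed.

(* laurent e = C[x, x^-1] with x = q^(e/2): the fractions p(x) / x^k. *)
Definition in_laurent (e : nat) : {pred ratfun} := fun f =>
  `[< exists (p : {poly C}) (k : nat),
        f = (map_poly ratC p).[sqrtq ^+ e] / (sqrtq ^+ e) ^+ k >].

Definition laurent (e : nat) : Type := {f : ratfun | in_laurent e f}.

HB.instance Definition _ e := [isSub of laurent e for sval].
HB.instance Definition _ e := [Choice of laurent e by <:].

Fact laurent_subring e : subring_closed (in_laurent e).
Proof.
have x0 k : (sqrtq ^+ e) ^+ k != 0 by rewrite !expf_neq0 ?sqrtq_neq0.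
split.
- apply/asboolP; exists 1, 0%N.
  by rewrite rmorph1 hornerC expr0 divr1.
- move=> _ _ /asboolP[p [k ->]] /asboolP[r [l ->]]; apply/asboolP.
  exists (p * 'X^l - r * 'X^k), (k + l)%N.
  rewrite rmorphB !rmorphM /= !map_polyXn !(hornerE, hornerXn) exprD mulrBl.
  by rewrite !invfM !mulrA mulfK // [_ / _ / _]mulrAC mulfK.
- move=> _ _ /asboolP[p [k ->]] /asboolP[r [l ->]]; apply/asboolP.
  exists (p * r), (k + l)%N.
  by rewrite rmorphM /= hornerM exprD invfM mulrACA.
Qed.

HB.instance Definition _ e :=
  GRing.SubChoice_isSubComNzRing.Build ratfun (in_laurent e) (laurent e)
    (laurent_subring e).

Definition laurent_of e (f : ratfun) (fP : in_laurent e f) : laurent e :=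
  exist (in_laurent e) f fP.

Fact laurentC_proof e (c : C) : in_laurent e (ratC c).
Proof.
apply/asboolP; exists c%:P, 0%N.
by rewrite map_polyC hornerC expr0 divr1.
Qed.

Definition laurentC e (c : C) : laurent e := laurent_of (laurentC_proof e c).

Fact laurent_exp_proof e (z : int) : in_laurent e ((sqrtq ^+ e) ^ z).
Proof.
apply/asboolP; case: z => k.
  by exists 'X^k, 0%N; rewrite map_polyXn hornerXn expr0 divr1.
by exists 1, k.+1; rewrite rmorph1 hornerC mul1r.
Qed.

Definition laurent_exp e (z : int) : laurent e :=
  laurent_of (laurent_exp_proof e z).

Fact laurent_widen_proof (f : laurent 2) : in_laurent 1 (val f).
Proof.
have /asboolP[p [k ->]] := valP f.
apply/asboolP; exists (p \Po 'X^2), (2 * k)%N.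
rewrite map_comp_poly map_polyXn horner_comp hornerXn expr1; congr (_ / _).
by rewrite -exprM.
Qed.

Definition laurent_widen (f : laurent 2) : laurent 1 :=
  laurent_of (laurent_widen_proof f).

Fact laurent_widen_zmod : zmod_morphism laurent_widen.
Proof. by move=> f g; apply: val_inj. Qed.
Fact laurent_widen_monoid : monoid_morphism laurent_widen.
Proof. by split=> [|f g]; apply: val_inj. Qed.
HB.instance Definition _ := GRing.isZmodMorphism.Build
  (laurent 2) (laurent 1) laurent_widen laurent_widen_zmod.
HB.instance Definition _ := GRing.isMonoidMorphism.Build
  (laurent 2) (laurent 1) laurent_widen laurent_widen_monoid.

Fact laurent_widenC f (x : laurent 1) :
  laurent_widen f * x = x * laurent_widen f.
Proof. exact: mulrC. Qed.

Definition Lq : comNzRingType := laurent 2.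

Definition qq : Lq := laurent_exp 2 1.

(* C[q^(1/2), q^(-1/2)] as an algebra over C[q, q^-1] *)
Definition Lhalf : algebra Lq := @Algebra Lq (laurent 1) laurent_widen laurent_widenC.

End Laurent.

(******************************************************************************)

(* Generators are numbered from 0: the g_i and s_i by 'I_n.-1, the t_j and the
   points permuted by 'S_n by 'I_n. *)
Section Symmetric.
Variable n : nat.

Definition lo (i : 'I_n.-1) : 'I_n := widen_ord (leq_pred n) i.

Fact hi_proof (i : 'I_n.-1) : (i.+1 < n)%N.
Proof. by case: n i => [[]|m i] //=; rewrite ltnS. Qed.

Definition hi (i : 'I_n.-1) : 'I_n := Ordinal (hi_proof i).

Definition s_ (i : 'I_n.-1) : 'S_n := tperm (lo i) (hi i).

(* Composition of functions, w after u; the library's product is reversed. *)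
Definition pcomp (w u : 'S_n) : 'S_n := (u * w)%g.

Lemma pcompE w u x : pcomp w u x = w (u x).
Proof. exact: permM. Qed.

Definition word_perm (s : seq 'I_n.-1) : 'S_n :=
  foldr (fun i w => pcomp (s_ i) w) 1%g s.

Definition reduced (w : 'S_n) (s : seq 'I_n.-1) : Prop :=
  word_perm s = w /\ forall s', word_perm s' = w -> (size s <= size s')%N.

Definition redw (w : 'S_n) : seq 'I_n.-1 := xget [::] [set s | reduced w s]%classic.

Lemma word_perm_cat s t : word_perm (s ++ t) = pcomp (word_perm s) (word_perm t).
Proof.
elim: s => [|i s IHs] /=; first by rewrite /pcomp mulg1.
by rewrite IHs /pcomp mulgA.
Qed.

Lemma word_permP w : exists s, word_perm s = w.
Proof.
have [ts -> _] := prod_tpermP w; elim: ts => [|[x y] ts [s IHs]].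
  by exists [::]; rewrite big_nil.
suff [t Et] : exists t, word_perm t = tperm x y.
  by exists (s ++ t); rewrite word_perm_cat big_cons /pcomp IHs Et.
wlog xy : x y / (x <= y)%N.
  by move=> W; case/orP: (leq_total x y) => /W // [t Et]; exists t; rewrite tpermC.
have [k] := ubnP (y - x)%N; elim: k x y xy => // k IHk x y xy le_k.
have [<-|neq] := eqVneq x y; first by exists [::]; rewrite tperm1.
have lt_xy : (x < y)%N by rewrite ltn_neqAle xy andbT.
have y0 : (0 < y)%N by exact: leq_ltn_trans lt_xy.
have n0 : (0 < n)%N by exact: leq_ltn_trans (ltn_ord y).
have y1 : (y.-1 < n.-1)%N by rewrite -ltnS !prednK.
pose i := Ordinal y1.
have hy : hi i = y by apply: val_inj; rewrite /= prednK.
have [||t Et] := IHk x (lo i); rewrite /=.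
- by rewrite -ltnS prednK.
- by rewrite -ltnS (leq_trans _ le_k) // ltnS -subn1 subnAC subn1 prednK // subn_gt0.
have [xi|xi] := eqVneq x (lo i).
  by exists [:: i]; rewrite /= /pcomp mul1g /s_ hy -xi.
exists (i :: t ++ [:: i]).
rewrite /= word_perm_cat /= Et /pcomp mul1g /s_ hy.
have -> : (tperm (lo i) y * tperm x (lo i) * tperm (lo i) y
          = tperm x (lo i) ^ tperm (lo i) y)%g by rewrite conjgE tpermV mulgA.
by rewrite tpermJ tpermL tpermD // eq_sym.
Qed.

Lemma redwP w : reduced w (redw w).
Proof.
apply: xgetPex; have [s0 Es0] := word_permP w.
have ex : exists k, `[< exists2 s, word_perm s = w & size s = k >].
  by exists (size s0); apply/asboolP; exists s0.
case: (ex_minnP ex) => k /asboolP[s Es <-] minS; exists s; split=> // t Et.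
by apply: minS; apply/asboolP; exists t.
Qed.

Definition len (w : 'S_n) : nat := size (redw w).

End Symmetric.

Definition Comp (d n : nat) : Type :=
  {mu : d.-tuple 'I_n.+1 | sumn [seq val i | i <- mu] == n}.

Definition comp_seq (d n : nat) (mu : Comp d n) : seq nat :=
  [seq val i | i <- val mu].
Coercion comp_seq : Comp >-> seq.

Section Young.
Variables (n : nat) (mu : seq nat).

Definition in_J (i : 'I_n.-1) : bool :=
  i.+1 \notin [seq sumn (take k mu) | k <- iota 1%N (size mu).-1].

Definition young : {group 'S_n} := <<[set s_ i | i in in_J]>>%G.

Definition mnum : nat := (n`! %/ \prod_(m <- mu) m`!)%N.

Definition min_coset_rep (w : 'S_n) : Prop :=
  forall u, u \in young -> (len w <= len (pcomp w u))%N.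

(* An enumeration, starting with 1, of the minimal length representatives of the
   left cosets w S_mu. *)
Definition coset_reps (pi : 'I_mnum -> 'S_n) : Prop :=
  [/\ injective pi, forall w, (exists k, pi k = w) <-> min_coset_rep w
    & forall k : 'I_mnum, k = 0%N :> nat -> pi k = 1%g].

End Young.

(******************************************************************************)

Section Hecke.
Variable F : realType.
Local Notation L := (Lq F).
Local Notation q := (qq F).

Section HeckeDef.
Variable n : nat.
Local Notation G := (@free_gen L 'I_n.-1).

Inductive hecke_rel : free_alg L 'I_n.-1 -> Prop :=
| hecke_far (i j : 'I_n.-1) : (i.+1 < j)%N || (j.+1 < i)%N ->
    hecke_rel (G i * G j - G j * G i)
| hecke_braid (i j : 'I_n.-1) : j = i.+1 :> nat ->
    hecke_rel (G i * G j * G i - G j * G i * G j)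
| hecke_quad (i : 'I_n.-1) :
    hecke_rel (G i ^+ 2 - (q *^ 1 + (q - 1) *^ G i)).

Definition hecke : algebra L := presented (hecke_rel : set _).

Definition hecke_gen (i : 'I_n.-1) : hecke := pres_gen (hecke_rel : set _) i.

End HeckeDef.

Definition sum_S3 (A : algebra L) (x y : A) : A :=
  1 + x + y + x * y + y * x + x * y * x.

(* No such i, j exist when n <= 2. *)
Inductive tl_rel (n : nat) : hecke n -> Prop :=
| tl_gen (i j : 'I_n.-1) : i = 0%N :> nat -> j = 1%N :> nat ->
    tl_rel (sum_S3 (hecke_gen i) (hecke_gen j)).

Definition tl (n : nat) : algebra L := quot_alg (@tl_rel n : set _).

Fixpoint hecke_tens (s : seq nat) : algebra L :=
  if s is m :: s' then tens (hecke m) (hecke_tens s') else base_alg L.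

(* The generator G_(j+1) of H_n(q), for s_(j+1) in the Young subgroup of s, seen in
   the tensor product; 0 when s_(j+1) is not in the Young subgroup. *)
Fixpoint hecke_tens_gen (s : seq nat) (j : nat) : hecke_tens s :=
  match s return hecke_tens s with
  | [::] => 0
  | m :: s' =>
      if (insub j : option 'I_m.-1) is Some i then hecke_gen i ⊗ 1
      else if (j < m)%N then 0 else 1 ⊗ hecke_tens_gen s' (j - m)
  end.

Variables (d n : nat).

Local Notation G := (fun i : 'I_n.-1 => @free_gen L ('I_n.-1 + 'I_n)%type (inl i)).
Local Notation T := (fun j : 'I_n => @free_gen L ('I_n.-1 + 'I_n)%type (inr j)).

Definition dinv : L := laurentC 2 (d%:R^-1 : F[i]).

(* t^-s, for t^d = 1 *)
Definition expN (A : algebra L) (t : A) (s : nat) : A := (t ^+ d.-1) ^+ s.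

Definition e_idem (A : algebra L) (t : 'I_n -> A) (i : 'I_n.-1) : A :=
  dinv *^ \sum_(s < d) t (lo i) ^+ s * expN (t (hi i)) s.

Inductive yh_rel : free_alg L ('I_n.-1 + 'I_n)%type -> Prop :=
| yh_far (i j : 'I_n.-1) : (i.+1 < j)%N || (j.+1 < i)%N ->
    yh_rel (G i * G j - G j * G i)
| yh_braid (i j : 'I_n.-1) : j = i.+1 :> nat ->
    yh_rel (G i * G j * G i - G j * G i * G j)
| yh_comm (i j : 'I_n) : yh_rel (T i * T j - T j * T i)
| yh_act (i : 'I_n.-1) (j : 'I_n) : yh_rel (T j * G i - G i * T (s_ i j))
| yh_tors (j : 'I_n) : yh_rel (T j ^+ d - 1)
| yh_quad (i : 'I_n.-1) :
    yh_rel (G i ^+ 2 - (q *^ 1 + (q - 1) *^ (e_idem T i * G i))).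

Definition yh : algebra L := presented (yh_rel : set _).

Definition yh_g (i : 'I_n.-1) : yh := pres_gen (yh_rel : set _) (inl i).
Definition yh_t (j : 'I_n) : yh := pres_gen (yh_rel : set _) (inr j).
Definition yh_e (i : 'I_n.-1) : yh := e_idem yh_t i.

Definition yh_gw (w : 'S_n) : yh := \prod_(i <- redw w) yh_g i.

Definition yh_T (j : 'I_n) : yh := dinv *^ \sum_(s < d) yh_t j ^+ s.

(* No such i, j exist when n <= 2. *)
Inductive ctl_rel : yh -> Prop :=
| ctl_gen (i j : 'I_n.-1) (k : 'I_n) :
    i = 0%N :> nat -> j = 1%N :> nat -> k = 0%N :> nat ->
    ctl_rel (yh_T k * yh_e i * yh_e j * sum_S3 (yh_g i) (yh_g j)).

Definition ctl : algebra L := quot_alg (ctl_rel : set _).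

(* A character of the group generated by the t_j is given by its values on the
   t_j. *)
Definition char_idem (chi : 'I_n -> F[i]) : yh :=
  \prod_(j < n) (dinv *^ \sum_(s < d) laurentC 2 (chi j ^+ s) *^ expN (yh_t j) s).

Definition char_act (w : 'S_n) (chi : 'I_n -> F[i]) (j : 'I_n) : F[i] :=
  chi ((w^-1)%g j).

End Hecke.

Section Maps.
Variables (F : realType) (d n : nat) (xi : d.-tuple F[i]) (mu : Comp d n).
Variable pi : 'I_(mnum n mu) -> 'S_n.
Local Notation L := (Lq F).

(* H^mu(q), identified with the tensor product of the H_(mu_i)(q); when 0 < d the
   sequence below is mu itself. *)
Definition hecke_mu : algebra L := hecke_tens F (head 0%N mu :: behead mu).

Definition tl_hecke : algebra L :=
  tens (tl F (head 0%N mu)) (hecke_tens F (behead mu)).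

Definition hecke_mu_gen (j : nat) : hecke_mu :=
  hecke_tens_gen F (head 0%N mu :: behead mu) j.

(* G_w for w in S_mu: a reduced word of w only uses letters of S_mu. *)
Definition hecke_mu_w (w : 'S_n) : hecke_mu :=
  \prod_(i <- redw w) hecke_mu_gen i.

Definition P1 : hecke_mu -> tl_hecke :=
  @tens_map L (hecke F (head 0%N mu)) (tl F (head 0%N mu)) _ _
    (quot_proj (@tl_rel F (head 0%N mu) : set _)) id.

Definition P1_mx : mat_alg hecke_mu (mnum n mu) -> mat_alg tl_hecke (mnum n mu) :=
  map_mx P1.

(* [reshape_index mu j] is the block of mu, numbered from 0, that contains j. *)
Definition chi1 (j : 'I_n) : F[i] := xi`_(reshape_index mu j).

Definition chi_ (k : 'I_(mnum n mu)) : 'I_n -> F[i] := char_act (pi k) chi1.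

Definition E_yh : yh F d n := \sum_(k < mnum n mu) char_idem d (chi_ k).

Definition E_ctl : ctl F d n := quot_proj (@ctl_rel F d n : set _) E_yh.

Fact Theta_proof (x : corner E_yh) :
  in_corner E_ctl (quot_proj (@ctl_rel F d n : set _) (val x)).
Proof.
have /asboolP[a ->] := valP x; apply/asboolP.
by exists (quot_proj (@ctl_rel F d n : set _) a); rewrite quot_projM.
Qed.

Definition Theta (x : corner E_yh) : corner E_ctl :=
  exist (in_corner E_ctl) _ (Theta_proof x).

(* The extension of scalars of H^mu(q) to C[q^(1/2), q^(-1/2)], with
   q^(z/2) = [hsqrtq z]. *)
Definition hecke_mu_half : algebra L := tens (Lhalf F) hecke_mu.

Definition hsqrtq (z : int) : Lhalf F := laurent_exp F 1 z.

(* The diagonal matrix U_mu is [U_mx 1], its inverse is [U_mx (-1)]. *)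
Definition U_mx (z : int) : 'M[hecke_mu_half]_(mnum n mu) :=
  \sum_(k < mnum n mu)
    ((hsqrtq (z * (len (pi k))%:Z) ⊗ 1 : hecke_mu_half) *: delta_mx k k).

(* The restriction to E_mu Y of the map on the scalar extension; l is the index
   with w(chi_l) = chi_k. *)
Definition is_Psi_tilde
    (f : corner E_yh -> mat_alg hecke_mu_half (mnum n mu)) : Prop :=
  @linear_map L (corner_ops E_yh) (ops (mat_alg hecke_mu_half (mnum n mu))) f /\
  forall k l (w : 'S_n) (x : corner E_yh),
    char_act w (chi_ l) =1 chi_ k ->
    val x = char_idem d (chi_ k) * yh_gw F d w ->
    let u := pcomp (pcomp (pi k)^-1%g w) (pi l) in
    f x = (hsqrtq ((len w)%:Z - (len u)%:Z) ⊗ hecke_mu_w u : hecke_mu_half)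
            *: delta_mx k l.

Definition is_Psi (f : corner E_yh -> mat_alg hecke_mu (mnum n mu)) : Prop :=
  exists2 f', is_Psi_tilde f' &
    forall x, map_mx (fun h : hecke_mu => (1 ⊗ h : hecke_mu_half)) (f x)
                = U_mx 1 *m f' x *m U_mx (-1).

Definition is_psi_bar (Psi : corner E_yh -> mat_alg hecke_mu (mnum n mu))
    (f : corner E_ctl -> mat_alg tl_hecke (mnum n mu)) : Prop :=
  @alg_hom L (corner_ops E_ctl) (ops (mat_alg tl_hecke (mnum n mu))) f /\
  f \o Theta =1 P1_mx \o Psi.

Definition is_phi_bar (Phi : mat_alg hecke_mu (mnum n mu) -> corner E_yh)
    (f : mat_alg tl_hecke (mnum n mu) -> corner E_ctl) : Prop :=
  @alg_hom L (ops (mat_alg tl_hecke (mnum n mu))) (corner_ops E_ctl) f /\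
  f \o P1_mx =1 Theta \o Phi.

End Maps.

Section DirectSum.
Variables (F : realType) (d n : nat) (xi : d.-tuple F[i]).
Variable pi : forall mu : Comp d n, 'I_(mnum n mu) -> 'S_n.

Definition mats : algebra (Lq F) :=
  prod_alg (fun mu : Comp d n => mat_alg (tl_hecke F mu) (mnum n mu)).

(* The summand E_mu of x in CTL is E_mu x. *)
Definition psi_sum
    (psi : forall mu, corner (E_ctl xi (pi (mu := mu))) ->
                      mat_alg (tl_hecke F mu) (mnum n mu)) : ctl F d n -> mats :=
  fun x mu => psi mu (corner_in (E_ctl xi (pi (mu := mu))) x).

Definition phi_sum
    (phi : forall mu, mat_alg (tl_hecke F mu) (mnum n mu) ->
                      corner (E_ctl xi (pi (mu := mu)))) : mats -> ctl F d n :=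
  fun M => \sum_(mu : Comp d n) val (phi mu (M mu)).

End DirectSum.

(* Main.v *)
(** The maps psi_mu and phi_mu are mutually inverse because Psi_mu and Phi_mu are,
    and because Theta_mu and P1 are onto.  The direct sum is then handled by the
    decomposition of CTL along the E_mu, which requires them to be central
    orthogonal idempotents with sum 1.

    A labelling c of the points by the indices of the roots of unity gives an
    idempotent E_c, characterized by its action on joint eigenvectors of the t_j:
    if t_j x = xi_(b j) x for all j, then E_c x is x when c = b and 0 otherwise.
    Hence E_mu, the sum of the E_c with c of content mu, acts on g_i E_b and on
    t_k E_b by 1 or 0 according to the content of b, and summing over b shows that
    it is central.

    That the chi_k are exactly the characters of content mu, each occurring once,
    is shown by counting: the mnum shortest coset representatives of the Young
    subgroup reach every labelling of content mu, and there are at least mnum such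
    labellings, since a fibre of the orbit map has at most mu_1! ... mu_d! elements. *)
Require Import Defs.
From HB Require Import structures.
From mathcomp Require Import all_boot all_order all_algebra all_fingroup.
From mathcomp Require Import boolp reals complex.
From mathcomp.multinomials Require Import monalg.

Set Implicit Arguments.
Unset Strict Implicit.
Unset Printing Implicit Defensive.

Import GRing.Theory Num.Theory.
Local Open Scope ring_scope.

(** * Labellings of a finite set: orbits and stabilisers under permutations of the points *)

Section Relabelling.
Local Open Scope nat_scope.
Variables T I : finType.
Implicit Types (b c : {ffun T -> I}) (u w : {perm T}).

(** The inverse matches [char_act]: composing with [xi] turns [relabel] into the action on
    characters. *)
Definition relabel w c : {ffun T -> I} := [ffun x => c ((w^-1)%g x)].

Definition fibre c (i : I) : {set T} := [set x | c x == i].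

Lemma relabelM u w c : relabel (u * w)%g c = relabel w (relabel u c).
Proof. by apply/ffunP => x; rewrite !ffunE invMg permM. Qed.

Lemma relabelP w b c : reflect (forall x, c (w x) = b x) (relabel w b == c).
Proof.
apply: (iffP eqP) => [<- x|bc]; first by rewrite ffunE permK.
by apply/ffunP => x; rewrite ffunE -bc permKV.
Qed.

Lemma card_fibre_relabel w c i : #|fibre (relabel w c) i| = #|fibre c i|.
Proof.
rewrite -(card_preimset _ (@perm_inj _ w)); apply: eq_card => x.
by rewrite !inE ffunE permK.
Qed.

(** A permutation fixing [b] preserves each fibre and is determined by its restrictions to the
    fibres. *)
Lemma card_stabiliser b :
  #|[set u | relabel u b == b]| <= \prod_i #|fibre b i|`!.
Proof.
pose f u := [ffun i : I => restr_perm (fibre b i) u].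
have uE u x : u \in [set u | relabel u b == b] -> u x = f u (b x) x.
  rewrite inE => /relabelP bu; rewrite ffunE restr_permE //; last by rewrite inE.
  by apply/astabsP => y /=; rewrite !inE /aperm bu.
rewrite -(@card_in_imset _ _ f) => [|u v uS vS uv].
  pose Q : {pred {ffun I -> {perm T}}} := family (fun i => perm_on (fibre b i)).
  apply: (@leq_trans #|Q|).
    apply/subset_leq_card/subsetP => _ /imsetP[u _ ->].
    by apply/familyP => i; rewrite ffunE; exact: restr_perm_on.
  rewrite card_family foldrE big_map enumT leq_eqVlt; apply/orP; left.
  by apply/eqP/eq_bigr => i _; rewrite card_perm.
by apply/permP => x; rewrite (uE u x) // (uE v x) // uv.
Qed.

(** If some [w0] carries [b] to [c], right translation by its inverse embeds this set in the
    stabiliser of [b]. *)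
Lemma card_relabel b c :
  #|[set w | relabel w b == c]| <= \prod_i #|fibre b i|`!.
Proof.
have [->|[w0]] := set_0Vmem [set w | relabel w b == c]; first by rewrite cards0.
rewrite inE => /eqP w0c; apply: leq_trans (card_stabiliser b).
rewrite -(card_imset _ (mulIg (w0^-1)%g)); apply/subset_leq_card/subsetP.
move=> _ /imsetP[w + ->]; rewrite !inE relabelM => /eqP->.
by rewrite -w0c -relabelM mulgV; apply/eqP/ffunP => x; rewrite ffunE invg1 perm1.
Qed.

(** The symmetric group is partitioned by the value of [relabel w b], and [card_relabel] bounds
    every part. *)
Lemma factorial_leq_orbit b :
  #|T|`! <= #|[set relabel w b | w : {perm T}]| * \prod_i #|fibre b i|`!.
Proof.
have -> : #|T|`! = #|[set: {perm T}]|.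
  rewrite -cardsT -card_perm; apply: eq_card => u.
  by rewrite !inE; apply/subsetP => x; rewrite inE.
rewrite -sum1_card (partition_big_imset (relabel^~ b)) /=.
have -> : [set relabel w b | w in [set: {perm T}]] = [set relabel w b | w : {perm T}].
  by apply/setP => c; apply/imsetP/imsetP => -[w _ ->]; exists w.
rewrite -sum_nat_const.
apply: leq_sum => c _; rewrite sum1_card; apply: leq_trans (card_relabel b c).
by apply/subset_leq_card/subsetP => w; rewrite unfold_in !inE.
Qed.

End Relabelling.

(** Equal fibre sizes make the two value lists rearrangements of each other. *)
Lemma relabel_trans n (I : finType) (b c : {ffun 'I_n -> I}) :
  (forall i, #|fibre b i| = #|fibre c i|) -> exists w, relabel w b = c.
Proof.
move=> bc; have count_fibre (f : {ffun 'I_n -> I}) i :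
    count_mem i [tuple f x | x < n] = #|fibre f i|.
  rewrite /= count_map cardE size_filter /= -enumT.
  by apply: eq_count => x; rewrite /= inE.
have /tuple_permP[p cp] : perm_eq [tuple c x | x < n] [tuple b x | x < n].
  by apply/allP => i _; apply/eqP; rewrite [LHS]count_fibre -bc [RHS]count_fibre.
(* Here [c x = b (p x)]; the inverse undoes the one inside [relabel]. *)
exists (p^-1)%g; apply/ffunP => x; rewrite ffunE invgK.
have /(congr1 (fun t : n.-tuple I => tnth t x)) :
    [tuple c x | x < n] = [tuple tnth [tuple b x | x < n] (p i) | i < n].
  exact: val_inj.
by rewrite !tnth_mktuple.
Qed.

(** * Blocks of consecutive positions cut out by a composition *)

Section Blocks.
Local Open Scope nat_scope.

Lemma reshape_index_cons m sh j :
  reshape_index (m :: sh) j = if j < m then 0 else (reshape_index sh (j - m)).+1.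
Proof.
rewrite /reshape_index /= subn_eq0; case: ifP => // jm.
by rewrite subSn // leqNgt jm.
Qed.

Lemma count_reshape_index sh i :
  count (fun j => reshape_index sh j == i) (iota 0 (sumn sh)) = nth 0 sh i.
Proof.
elim: sh i => [|m sh IHsh] i /=; first by rewrite nth_nil.
rewrite iotaD count_cat add0n.
have -> : iota m (sumn sh) = map (addn m) (iota 0 (sumn sh)) by rewrite -iotaDl addn0.
rewrite count_map.
have -> : count (fun j => reshape_index (m :: sh) j == i) (iota 0 m) = (i == 0) * m.
  rewrite -[X in _ * X](size_iota 0 m); set a := (X in count X).
  rewrite (@eq_in_count _ a (fun=> i == 0)) => [|j].
    by case: (i == 0); rewrite ?mul1n ?mul0n ?count_predT ?count_pred0.
  by rewrite mem_iota /a reshape_index_cons eq_sym => /andP[_ ->].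
rewrite (@eq_count _ (preim _ _) (fun j => (reshape_index sh j).+1 == i)) => [|j /=].
  case: i => [|i] /=; last first.
    by rewrite -IHsh mul0n add0n; apply: eq_count => j; rewrite eqSS.
  by rewrite mul1n (@eq_count _ _ pred0) // count_pred0 addn0.
by rewrite reshape_index_cons ltnNge leq_addr addKn.
Qed.

(** Two neighbouring positions are separated only at a proper partial sum, which is what [in_J]
    excludes. *)
Lemma reshape_indexS sh j : j.+1 < sumn sh ->
    j.+1 \notin [seq sumn (take k sh) | k <- iota 1 (size sh).-1] ->
  reshape_index sh j.+1 = reshape_index sh j.
Proof.
elim: sh j => //= m sh IHsh j ltj.
case: sh IHsh ltj => [|m' sh] IHsh ltj.
  move=> _; rewrite !reshape_index_cons.
  by move: ltj; rewrite /= addn0 => ltj; rewrite ltj ltnW.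
rewrite /= addn0 inE negb_or => /andP[jm notin]; rewrite !(reshape_index_cons m).
case: (ltnP j m) => [lt_jm|le_mj].
  by rewrite ltn_neqAle jm lt_jm.
rewrite ltnNge ltnW //= subSn // IHsh //.
  by rewrite /= in ltj *; rewrite -subSn // ltn_subLR // ltnW.
(* Adding [m] turns a partial sum of the tail into one of the whole list. *)
apply: contra notin => /mapP[k]; rewrite mem_iota => /andP[k1 k2] jk.
apply/mapP; exists k.+1; rewrite ?mem_iota /=; last by rewrite -jk addnS subnKC.
by move: k1 k2; rewrite /= !add1n !ltnS => -> ->.
Qed.

End Blocks.

(** * Labellings of given content and coset representatives of the Young subgroup *)

Section Content.
Local Open Scope nat_scope.
Variables d n : nat.
Implicit Types (mu : Comp d n) (c : {ffun 'I_n -> 'I_d}).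

Lemma sumn_comp mu : sumn mu = n.
Proof. exact/eqP/(valP mu). Qed.

Lemma size_comp mu : size mu = d.
Proof. by rewrite size_map size_tuple. Qed.

Lemma nth_comp mu (i : 'I_d) : nth 0 mu i = tnth (val mu) i.
Proof. by rewrite (nth_map (tnth (val mu) i)) ?size_tuple // -tnth_nth. Qed.

Fact block_proof mu (j : 'I_n) : reshape_index mu j < d.
Proof. by rewrite -[X in _ < X](size_comp mu) reshape_indexP // sumn_comp. Qed.

(** The labelling behind [chi1], which is its composite with [xi]. *)
Definition block mu : {ffun 'I_n -> 'I_d} :=
  [ffun j => Ordinal (block_proof mu j)].

Lemma card_fibre_block mu i : #|fibre (block mu) i| = nth 0 mu i.
Proof.
rewrite -count_reshape_index sumn_comp -val_enum_ord count_map cardE size_filter.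
by rewrite enumT; apply: eq_count => j; rewrite !inE ffunE.
Qed.

Lemma sum_card_fibre c : \sum_i #|fibre c i| = n.
Proof.
rewrite -[RHS]card_ord -sum1_card (partition_big c xpredT) //=.
by apply: eq_bigr => i _; rewrite -sum1_card; apply: eq_bigl => j; rewrite inE.
Qed.

Lemma card_fibre_ltn c i : #|fibre c i| < n.+1.
Proof. by rewrite ltnS -[X in _ <= X]card_ord max_card. Qed.

Fact content_proof c :
  sumn [seq val i | i <- [tuple Ordinal (card_fibre_ltn c i) | i < d]] == n.
Proof.
by rewrite sumnE big_map big_tuple -[X in _ == X](sum_card_fibre c);
  apply/eqP/eq_bigr => i _; rewrite tnth_mktuple.
Qed.

Definition content c : Comp d n :=
  exist (fun t : d.-tuple 'I_n.+1 => sumn [seq val i | i <- t] == n) _ (content_proof c).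

Lemma contentP c mu :
  reflect (forall i, #|fibre c i| = nth 0 mu (i : 'I_d)) (content c == mu).
Proof.
apply: (iffP eqP) => [<- i|cmu]; first by rewrite nth_comp tnth_mktuple.
by apply/val_inj/eq_from_tnth => i; apply: val_inj; rewrite tnth_mktuple /= cmu nth_comp.
Qed.

Lemma content_block mu : content (block mu) = mu.
Proof. by apply/eqP/contentP => i; exact: card_fibre_block. Qed.

Lemma content_relabel w c : content (relabel w c) = content c.
Proof.
apply/eqP/contentP => i.
by rewrite card_fibre_relabel nth_comp tnth_mktuple.
Qed.

Lemma relabel_block mu c : content c = mu -> exists w, relabel w (block mu) = c.
Proof.
move=> /eqP/contentP cmu; apply: relabel_trans => i.
by rewrite card_fibre_block cmu.
Qed.

Lemma orbit_block mu :
  [set relabel w (block mu) | w : 'S_n] = [set c | content c == mu].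
Proof.
apply/setP => c; rewrite inE; apply/imsetP/eqP => [[w _ ->]|/relabel_block[w <-]].
  by rewrite content_relabel content_block.
by exists w.
Qed.

(** The stabiliser of [block mu] is a group, and it contains the generators [s_ i] because the two
    points swapped lie in one block. *)
Lemma young_block mu u : u \in young n mu -> relabel u (block mu) = block mu.
Proof.
pose S := [set u : 'S_n | relabel u (block mu) == block mu].
have gS : group_set S.
  apply/group_setP; split=> [|v w]; rewrite !inE.
    by apply/eqP/ffunP => x; rewrite ffunE invg1 perm1.
  by move=> /eqP vb /eqP wb; rewrite relabelM vb wb.
suff: young n mu \subset Group gS by move=> /subsetP sub /sub; rewrite inE => /eqP.
rewrite gen_subG; apply/subsetP => _ /imsetP[i Ji ->]; rewrite inE.
have bi : block mu (hi i) = block mu (lo i).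
  apply: val_inj; rewrite !ffunE /= reshape_indexS // sumn_comp.
  exact: (ltn_ord (hi i)).
apply/relabelP => x; rewrite /s_.
by case: tpermP => [->|->|].
Qed.

(** As [mnum] is a Euclidean quotient, this comes from dividing [factorial_leq_orbit] by the product
    of factorials. *)
Lemma mnum_block mu : mnum n mu <= #|[set c | content c == mu]|.
Proof.
set P := \prod_(m <- mu) m`!.
have P_gt0 : 0 < P by rewrite prodn_gt0 // => m; exact: fact_gt0.
rewrite /mnum -/P -[X in _ <= X](mulnK _ P_gt0); apply: leq_div2r.
rewrite -orbit_block.
have := factorial_leq_orbit (block mu); rewrite card_ord; congr (_ <= _ * _).
rewrite /P big_map big_tuple; apply: eq_bigr => i _.
by rewrite card_fibre_block nth_comp.
Qed.

Section Representatives.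
Variables (mu : Comp d n) (pi : 'I_(mnum n mu) -> 'S_n).
Hypothesis pi_reps : coset_reps pi.

(** The Young subgroup fixes [block mu], so [w] may be replaced by a shortest element of its coset,
    which is some [pi k]. *)
Lemma coset_reps_imset :
  [set relabel (pi k) (block mu) | k : 'I_(mnum n mu)] = [set c | content c == mu].
Proof.
case: pi_reps => _ piP _; apply/setP => c; rewrite inE.
apply/imsetP/eqP => [[k _ ->]|/relabel_block[w <-]].
  by rewrite content_relabel content_block.
case: (@arg_minnP _ 1%g [in young n mu] (fun u : 'S_n => len (Defs.pcomp w u))
         (group1 (young n mu))).
move=> u uY min_u.
have /piP[k pik] : min_coset_rep mu (Defs.pcomp w u).
  move=> v vY; have := min_u (v * u)%g (groupM vY uY).
  by rewrite /Defs.pcomp !mulgA.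
by exists k => //; rewrite pik /Defs.pcomp relabelM young_block.
Qed.

(** Pigeonhole: the image of a set of [mnum] indices has at least [mnum] elements. *)
Lemma coset_reps_inj : injective (fun k => relabel (pi k) (block mu)).
Proof.
suff /imset_injP inj :
    #|[set relabel (pi k) (block mu) | k in 'I_(mnum n mu)]| == #|'I_(mnum n mu)|.
  by move=> k l; exact: inj.
by rewrite eqn_leq leq_imset_card coset_reps_imset card_ord mnum_block.
Qed.

End Representatives.

End Content.

(** * Induction on generators in free and presented algebras *)

Section Induction.
Variables (R : comNzRingType) (G : choiceType).

Lemma free_alg_ind (P : free_alg R G -> Prop) :
  (forall x y, P x -> P y -> P (x + y)) -> (forall x y, P x -> P y -> P (x * y)) ->
  (forall a, P (alg_in (free_alg R G) a)) -> (forall g, P (free_gen R g)) ->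
  forall x, P x.
Proof.
move=> PD PM Pc Pg x.
rewrite (monalgE (x : {malg R[fmonom G]})).
apply: (big_ind P) => [||k _]; first by rewrite -(rmorph0 (alg_in (free_alg R G))).
  exact: PD.
(* The remaining case is a single term, handled by splitting off the letters of its word one at a
   time. *)
move: (mcoeff k x) => a; case: k => s; elim: s => [|g s IHs].
  have -> : FMonom [::] = mone :> fmonom G by apply: val_inj; rewrite /= fm1.
  exact: Pc.
suff -> : << a *g FMonom (g :: s) >>
    = << 1 *g fmu g >> * << a *g FMonom s >> :> {malg R[fmonom G]}.
  by apply: PM => //; exact: Pg.
rewrite malgM_def fgmulUU mul1r; congr << _ *g _ >>.
by apply: val_inj => /=; rewrite fmM fmU.
Qed.

Lemma presented_ind rel (P : presented rel -> Prop) :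
  (forall x y, P x -> P y -> P (x + y)) -> (forall x y, P x -> P y -> P (x * y)) ->
  (forall a, P (alg_in (presented rel) a)) -> (forall g, P (@pres_gen R G rel g)) ->
  forall x, P x.
Proof.
move=> PD PM Pc Pg x; have [u <-] := quot_proj_surj x.
elim/free_alg_ind: u => [u v Pu Pv|u v Pu Pv|a|g].
- by rewrite quot_projD; exact: PD.
- by rewrite quot_projM; exact: PM.
- exact: Pc.
- exact: Pg.
Qed.

(** The centraliser of [e] contains the scalars and is closed under sums and products. *)
Lemma presented_central rel (e : presented rel) :
  (forall g, GRing.comm e (@pres_gen R G rel g)) -> forall x, GRing.comm e x.
Proof.
move=> eg; apply: (@presented_ind rel (GRing.comm e)) => [x y|x y|a|g].
- exact: commrD.
- exact: commrM.
- exact/commr_sym/alg_inC.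
- exact: eg.
Qed.

End Induction.

(** The image is a subalgebra containing all pure tensors, which generate the target. *)
Lemma tens_map_surj (R : comNzRingType) (A A' B B' : algebra R)
    (f : A -> A') (g : B -> B') :
    @alg_hom R (ops A) (ops A') f -> @alg_hom R (ops B) (ops B') g ->
    (forall y, exists x, f x = y) -> (forall y, exists x, g x = y) ->
  forall y, exists x, tens_map f g x = y.
Proof.
move=> fh gh fS gS; have [[/= tD tZ] tM t1] := tens_map_hom fh gh.
elim/presented_ind => [_ _ [x <-] [y <-]|_ _ [x <-] [y <-]|a|[y z]].
- by exists (x + y).
- by exists (x * y).
- by exists (alg_in (tens A B) a); have := tZ a 1; rewrite /ascale t1 !mulr1.
- have [x <-] := fS y; have [x' <-] := gS z.
  by exists (x ⊗ x'); exact: tens_mapE.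
Qed.

(** * Spectral projectors of one element [t] with [t ^+ d = 1] *)

Section Spectral.
Variables (F : realType) (d : nat).
Hypothesis d_gt0 : (0 < d)%N.
Local Notation C := F[i].

Fact laurentC_zmod : zmod_morphism (@laurentC F 2).
Proof. by move=> x y; apply: val_inj; rewrite /= rmorphB. Qed.
Fact laurentC_monoid : monoid_morphism (@laurentC F 2).
Proof. by split=> [|x y]; apply: val_inj; rewrite /= ?rmorph1 ?rmorphM. Qed.
HB.instance Definition _ :=
  GRing.isZmodMorphism.Build C (laurent F 2) (@laurentC F 2) laurentC_zmod.
HB.instance Definition _ :=
  GRing.isMonoidMorphism.Build C (laurent F 2) (@laurentC F 2) laurentC_monoid.

Lemma unity_root_neq0 (y : C) : y ^+ d = 1 -> y != 0.
Proof. by apply: contra_eq_neq => ->; rewrite expr0n gtn_eqF // eq_sym oner_eq0. Qed.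

(** For [y != 1] the geometric sum is killed by the nonzero factor [y - 1]. *)
Lemma unity_root_mean (y : C) :
  y ^+ d = 1 -> d%:R^-1 * \sum_(s < d) y ^+ s = (y == 1)%:R.
Proof.
move=> yd; have [->|y1] := eqVneq.
  under eq_bigr do rewrite expr1n.
  by rewrite sumr_const card_ord mulVf // pnatr_eq0 -lt0n.
have /eqP : (y - 1) * \sum_(s < d) y ^+ s = 0 by rewrite -subrX1 yd subrr.
by rewrite mulf_eq0 subr_eq0 (negbTE y1) /= => /eqP->; rewrite mulr0.
Qed.

(** For [0 < s], multiplication by a root [z] permutes the roots, so the sum is invariant under the
    factor [z ^+ s], chosen different from 1. *)
Lemma sum_unity_root_expr (xi : d.-tuple C) (s : 'I_d) :
    uniq xi -> all d.-unity_root xi ->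
  \sum_(i < d) xi`_i ^+ s = if s == 0%N :> nat then d%:R else 0.
Proof.
move=> xi_uniq xi_root; have [->|s_neq0] := eqVneq.
  by under eq_bigr do rewrite expr0; rewrite sumr_const card_ord.
(* Such a [z] exists: at most [s < d] elements satisfy [z ^+ s = 1]. *)
have [z zxi zs] : exists2 z, z \in xi & z ^+ s != 1.
  apply/hasP; rewrite -[has _ _]negbK -all_predC; apply/negP => /= all_s.
  suff: (d <= s)%N by rewrite leqNgt ltn_ord.
  rewrite -[X in (X <= _)%N](size_tuple xi) (@max_unity_roots C s) ?lt0n //.
  by apply: sub_all all_s => z /=; rewrite negbK => /eqP/unity_rootP.
have mem_xi := mem_unity_roots d_gt0 xi_root xi_uniq (size_tuple xi).
have z0 : z != 0 by apply/unity_root_neq0/unity_rootP/(allP xi_root).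
have sumE : \sum_(i < d) xi`_i ^+ s = \sum_(x <- xi) x ^+ s.
  by rewrite big_tuple; apply: eq_bigr => i _; rewrite -tnth_nth.
have /eqP : (z ^+ s - 1) * \sum_(i < d) xi`_i ^+ s = 0.
  rewrite mulrBl mul1r; apply/eqP; rewrite subr_eq0 sumE; apply/eqP.
  have zxi_uniq : uniq [seq z * x | x <- xi] by rewrite map_inj_uniq //; exact: mulfI.
  rewrite [RHS](perm_big [seq z * x | x <- xi]) /=.
    by rewrite big_map mulr_sumr; apply: eq_bigr => x _; rewrite exprMn.
  apply: uniq_perm => // x; have [] // := uniq_min_size zxi_uniq (s2 := xi).
  - move=> _ /mapP[y yxi ->]; rewrite -mem_xi; apply/unity_rootP.
    rewrite exprMn; have /unity_rootP-> := allP xi_root _ zxi.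
    by have /unity_rootP-> := allP xi_root _ yxi; rewrite mulr1.
  - by rewrite size_map.
by rewrite mulf_eq0 subr_eq0 (negbTE zs) => /eqP.
Qed.

Variable A : algebra (Lq F).
Implicit Types (a b : C) (t x : A).

Definition cst a : A := alg_in A (laurentC 2 a).
HB.instance Definition _ := GRing.RMorphism.copy cst (alg_in A \o @laurentC F 2).

Lemma cstC a x : cst a * x = x * cst a.
Proof. exact: alg_inC. Qed.

(** One factor of [char_idem]: the projector onto the [a]-eigenspace of [t] when both are
    [d]-torsion. *)
Definition spectral a t : A :=
  dinv F d *^ \sum_(s < d) laurentC 2 (a ^+ s) *^ expN d t s.

Lemma spectralE a t :
  spectral a t = cst d%:R^-1 * \sum_(s < d) (cst a * t ^+ d.-1) ^+ s.
Proof.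
congr (_ * _); apply: eq_bigr => s _.
by rewrite exprMn_comm /GRing.comm ?cstC // -rmorphXn.
Qed.

(** By [spectralE] the projector is the mean of the powers of a t^-1, which acts on [x] as the root
    of unity a b^-1; [unity_root_mean] applies. *)
Lemma spectral_eigen a b t x : a ^+ d = 1 -> b ^+ d = 1 ->
  t * x = cst b * x -> spectral a t * x = if a == b then x else 0.
Proof.
move=> ad bd tx; have tX k : t ^+ k * x = cst (b ^+ k) * x.
  elim: k => [|k IHk]; first by rewrite !expr0 rmorph1.
  by rewrite exprS -mulrA IHk mulrA -cstC -mulrA tx mulrA -rmorphM -exprSr.
have aX k : (cst a * t ^+ d.-1) ^+ k * x = cst ((a * b ^+ d.-1) ^+ k) * x.
  elim: k => [|k IHk]; first by rewrite !expr0 rmorph1.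
  rewrite exprS -mulrA IHk mulrA -cstC -mulrA -[_ * _ * x]mulrA tX.
  by rewrite !mulrA -!rmorphM -mulrA -exprSr.
rewrite spectralE -mulrA mulr_suml; under eq_bigr do rewrite aX.
rewrite -mulr_suml -rmorph_sum mulrA -rmorphM unity_root_mean; last first.
  by rewrite exprMn ad exprAC bd expr1n mulr1.
have b0 := unity_root_neq0 bd.
have -> : (a * b ^+ d.-1 == 1) = (a == b).
  by rewrite -(inj_eq (mulIf b0)) mul1r -mulrA -exprSr prednK // bd mulr1.
by case: eqP; rewrite ?rmorph1 ?mul1r ?rmorph0 ?mul0r.
Qed.

(** The element [z], which is a t^-1, fixes the mean of its own powers, and [t * z] is the scalar
    [a]. *)
Lemma mul_spectral a t : a ^+ d = 1 -> t ^+ d = 1 ->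
  t * spectral a t = cst a * spectral a t.
Proof.
move=> ad td; pose z := cst a * t ^+ d.-1.
have zd : z ^+ d = 1.
  by rewrite exprMn_comm /GRing.comm ?cstC // -rmorphXn ad rmorph1 mul1r exprAC td expr1n.
have zS : z * spectral a t = spectral a t.
  apply/eqP; rewrite -subr_eq0 -{2}[spectral a t]mul1r -mulrBl spectralE mulrA -cstC.
  by rewrite -mulrA -subrX1 zd subrr mulr0.
rewrite -{1}zS mulrA [t * z]mulrA -cstC -!mulrA [t * _]mulrA -exprS prednK //.
by rewrite td mul1r.
Qed.

(** After exchanging the sums, the power sums of the roots leave only the term [s = 0]. *)
Lemma sum_spectral (xi : d.-tuple C) t : uniq xi -> all d.-unity_root xi ->
  \sum_(i < d) spectral xi`_i t = 1.
Proof.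
move=> xi_uniq xi_root; rewrite -mulr_sumr exchange_big /=.
have sumE (s : 'I_d) : \sum_(i < d) laurentC 2 (xi`_i ^+ s) *^ expN d t s
                     = cst (if s == 0%N :> nat then d%:R else 0) * expN d t s.
  by rewrite -(sum_unity_root_expr _ xi_uniq xi_root) rmorph_sum mulr_suml.
under eq_bigr do rewrite sumE.
rewrite (bigD1 (Ordinal d_gt0)) //= [X in _ + X]big1 => [|s s_neq0].
  rewrite addr0 /expN expr0 mulr1 -[LHS](rmorphM cst).
  by rewrite mulVf ?rmorph1 // pnatr_eq0 -lt0n.
by rewrite ifN ?rmorph0 ?mul0r.
Qed.

Lemma comm_spectral a t u : GRing.comm u t -> GRing.comm u (spectral a t).
Proof.
move=> ut; rewrite spectralE; apply: commrM; first exact/commr_sym/cstC.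
apply: commr_sum => s _; apply: commrX; apply: commrM; last exact: commrX.
exact/commr_sym/cstC.
Qed.

End Spectral.

(** * Joint eigenvectors and idempotents of commuting torsion elements *)

Section CommutingTorsion.
Variables (F : realType) (d n : nat).
Hypothesis d_gt0 : (0 < d)%N.
Variable xi : d.-tuple F[i].
Hypotheses (xi_uniq : uniq xi) (xi_root : all d.-unity_root xi).
Variables (A : algebra (Lq F)) (t : 'I_n -> A).
Hypotheses (t_tors : forall j, t j ^+ d = 1) (tC : forall j k, t j * t k = t k * t j).
Implicit Types (b c : {ffun 'I_n -> 'I_d}) (x : A) (mu nu : Comp d n).

Lemma root_expr (i : 'I_d) : xi`_i ^+ d = 1.
Proof.
by apply/unity_rootP/(allP xi_root); rewrite mem_nth // size_tuple.
Qed.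

Lemma root_eq (i j : 'I_d) : (xi`_i == xi`_j) = (i == j).
Proof. by rewrite nth_uniq ?size_tuple. Qed.

Definition eigen b x := forall j, t j * x = cst A xi`_(b j) * x.

Definition idem c : A := \prod_(j < n) spectral d xi`_(c j) (t j).

Lemma idem_mul b c x : eigen b x -> idem c * x = if c == b then x else 0.
Proof.
move=> bx; pose f j : A := spectral d xi`_(c j) (t j).
have fx j : f j * x = if c j == b j then x else 0.
  by rewrite (spectral_eigen d_gt0 (root_expr _) (root_expr _) (bx j)) root_eq.
(* The product is taken over an arbitrary list so that induction applies. *)
have main (s : seq 'I_n) :
    (\prod_(j <- s) f j) * x = if all (fun j => c j == b j) s then x else 0.
  elim: s => [|k s IHs]; first by rewrite big_nil mul1r.
  rewrite big_cons -mulrA IHs /=; case: ifP => _; last by rewrite andbF mulr0.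
  by rewrite fx andbT.
rewrite /idem main; congr (if _ then _ else _).
apply/allP/eqP => [cb|-> //]; apply/ffunP => j.
exact/eqP/cb/mem_index_enum.
Qed.

(** [t j] commutes past the other factors until it meets the projector for [j], which supplies the
    eigenvalue. *)
Lemma eigen_idem c : eigen c (idem c).
Proof.
move=> j; pose f k : A := spectral d xi`_(c k) (t k).
have main (s : seq 'I_n) : j \in s ->
    t j * \prod_(k <- s) f k = cst A xi`_(c j) * \prod_(k <- s) f k.
  elim: s => [|k s IHs]; first by rewrite in_nil.
  rewrite big_cons inE; have [-> _|jk /= js] := eqVneq j k.
    have tf : t k * f k = cst A xi`_(c k) * f k by exact: mul_spectral (root_expr _) _.
    by rewrite mulrA tf -mulrA.
  have fC : t j * f k = f k * t j by apply: comm_spectral; exact: tC.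
  by rewrite mulrA fC -mulrA IHs // mulrA -cstC -mulrA.
exact: main (mem_index_enum j).
Qed.

(** Distributivity: the sum is the product over [j] of the sums of all projectors of [t j], each
    equal to 1. *)
Lemma sum_idem : \sum_c idem c = 1.
Proof.
rewrite -(bigA_distr_bigA (fun j (i : 'I_d) => spectral d xi`_i (t j))) big1 // => j _.
exact: sum_spectral.
Qed.

Lemma eigen_comm b x y : (forall j, y * t j = t j * y) -> eigen b x -> eigen b (y * x).
Proof. by move=> yt bx j; rewrite mulrA -yt -mulrA bx !mulrA cstC. Qed.

Lemma eigen_relabel (w : 'S_n) b x y :
  (forall j, t (w j) * y = y * t j) -> eigen b x -> eigen (relabel w b) (y * x).
Proof.
move=> yt bx j; rewrite mulrA -[in LHS](permKV w j) yt -mulrA bx !mulrA cstC.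
by rewrite ffunE.
Qed.

(** The E_mu of the theorem indexed by labellings instead of coset representatives; see [E_yhE]. *)
Definition E_sum mu : A := \sum_(c | content c == mu) idem c.

Lemma E_sum_eigen mu b x :
  eigen b x -> E_sum mu * x = if content b == mu then x else 0.
Proof.
move=> bx; rewrite mulr_suml (eq_bigr _ (fun c _ => idem_mul c bx)).
case: ifPn => cb.
  by rewrite (bigD1 b) //= eqxx big1 ?addr0 // => c /andP[_ /negbTE->].
by rewrite big1 // => c cc; rewrite ifN //; apply: contraNneq cb => <-.
Qed.

(** Expanding 1 as the sum of the [idem b] on the right, both products send [idem b] to [y * idem b]
    or to 0, according to the content of [b]. *)
Lemma E_sum_comm mu y :
    (forall b, exists2 b', content b' = content b & eigen b' (y * idem b)) ->
  GRing.comm (E_sum mu) y.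
Proof.
move=> yb; rewrite /GRing.comm -[LHS]mulr1 -[RHS]mulr1 -sum_idem.
rewrite [LHS]mulr_sumr [RHS]mulr_sumr.
apply: eq_bigr => b _; have [b' cb' eb'] := yb b.
rewrite -!mulrA (E_sum_eigen _ eb') (E_sum_eigen _ (@eigen_idem b)) cb'.
by case: ifP; rewrite ?mulr0.
Qed.

Lemma E_sumM mu nu : E_sum mu * E_sum nu = if mu == nu then E_sum mu else 0.
Proof.
rewrite {2}/E_sum mulr_sumr.
rewrite (eq_bigr _ (fun b _ => E_sum_eigen mu (@eigen_idem b))).
case: eqP => [->|mn]; first by apply: eq_bigr => b ->.
by rewrite big1 // => b /eqP->; rewrite ifN // eq_sym; apply/eqP.
Qed.

Lemma sum_E_sum : \sum_mu E_sum mu = 1.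
Proof. by rewrite -sum_idem (partition_big (@content d n) xpredT). Qed.

End CommutingTorsion.

(** * The central idempotents E_mu of the Yokonuma-Hecke algebra *)

Section YokonumaIdempotents.
Variables (F : realType) (d n : nat).
Hypothesis d_gt0 : (0 < d)%N.
Variable xi : d.-tuple F[i].
Hypotheses (xi_uniq : uniq xi) (xi_root : all d.-unity_root xi).
Local Notation t := (@yh_t F d n).
Local Notation g := (@yh_g F d n).

Lemma yh_t_expr j : t j ^+ d = 1.
Proof.
rewrite -[t j ^+ d](rmorphXn (quot_pi _)) -[1](rmorph1 (quot_pi _)).
by apply: quot_proj_eq; exact: yh_tors.
Qed.

Lemma yh_tC j k : t j * t k = t k * t j.
Proof. by rewrite -!quot_projM; apply: quot_proj_eq; exact: yh_comm. Qed.

Lemma yh_tg j i : t j * g i = g i * t (s_ i j).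
Proof. by rewrite -!quot_projM; apply: quot_proj_eq; exact: yh_act. Qed.

(** Left multiplication by [g i] relabels eigenvectors by [s_ i], that by [t j] keeps the labelling;
    both preserve content. *)
Lemma E_sum_central mu (x : yh F d n) : GRing.comm (E_sum xi t mu) x.
Proof.
have eigen_t := eigen_idem d_gt0 xi_root yh_t_expr yh_tC.
have comm := E_sum_comm d_gt0 xi_uniq xi_root yh_t_expr yh_tC mu.
apply: presented_central => -[i|j].
- apply: (comm (g i)) => b; exists (relabel (s_ i) b); first exact: content_relabel.
  apply: eigen_relabel (eigen_t b) => j.
  (* The defining relation is used at the point [s_ i j], and [s_ i] is an involution. *)
  by rewrite [LHS]yh_tg /s_ tpermK.
- apply: (comm (t j)) => b; exists b; first by [].
  apply: eigen_comm (eigen_t b) => k.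
  exact: yh_tC.
Qed.

Lemma E_yhE (mu : Comp d n) (pi : 'I_(mnum n mu) -> 'S_n) :
  coset_reps pi -> E_yh xi pi = E_sum xi t mu.
Proof.
move=> pi_reps; rewrite /E_sum -(eq_bigl _ _ (in_set _)) -(coset_reps_imset pi_reps).
rewrite big_imset => [|k l _ _]; last exact: coset_reps_inj.
apply: eq_bigr => k _; congr (char_idem d); apply: functional_extensionality_dep => j.
by rewrite !ffunE.
Qed.

End YokonumaIdempotents.

(** * Passage of central orthogonal idempotents to a quotient *)

Section QuotientIdempotents.
Variables (R : comNzRingType) (A : algebra R) (S : A -> Prop) (I : finType) (e : I -> A).
Local Notation p := (quot_proj S).

Lemma quot_proj_central (x : A) :
  (forall y, GRing.comm x y) -> forall y, GRing.comm (p x) y.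
Proof.
move=> xC y; have [z <-] := quot_proj_surj y.
by rewrite /GRing.comm -!quot_projM xC.
Qed.

Lemma quot_proj_orth :
    (forall i j, e i * e j = if i == j then e i else 0) ->
  forall i j, p (e i) * p (e j) = if i == j then p (e i) else 0.
Proof.
move=> eM i j; rewrite -quot_projM eM; case: eqP => // _; exact: (rmorph0 (quot_pi S)).
Qed.

Lemma quot_proj_complete : \sum_i e i = 1 -> \sum_i p (e i) = 1.
Proof.
by move=> e1; rewrite -(quot_proj1 S) -e1; symmetry; exact: (rmorph_sum (quot_pi S)).
Qed.

End QuotientIdempotents.

(** * Projection of an algebra onto the corner of a central idempotent *)

Section Corner.
Variables (R : comNzRingType) (A B : algebra R) (e : A).

Lemma corner_unitl (ee : e * e = e) (x : corner e) : e * val x = val x.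
Proof. by have /asboolP[a ->] := valP x; rewrite mulrA ee. Qed.

Variable f : corner e -> B.
Hypotheses (f_hom : @alg_hom R (corner_ops e) (ops B) f).
Hypotheses (eC : forall x, GRing.comm e x) (ee : e * e = e).

Lemma corner_in_hom : @alg_hom R (ops A) (ops B) (f \o corner_in e).
Proof.
case: f_hom => -[/= fD fZ] fM f1; split; first split=> [x y|a x] /=.
- by rewrite -fD; congr f; apply: val_inj; rewrite /= mulrDr.
- by rewrite -fZ; congr f; apply: val_inj; rewrite /= /ascale !mulrA alg_inC.
- move=> x y /=; rewrite -fM; congr f; apply: val_inj => /=.
  by rewrite [RHS]mulrA -[_ * _ * e]mulrA -(eC x) !mulrA ee.
- by rewrite -[RHS]f1; congr f; apply: val_inj; rewrite /= mulr1.
Qed.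

End Corner.

(** * Decomposition of an algebra along complete central orthogonal idempotents *)

Section CompleteIdempotents.
Variables (R : comNzRingType) (A : algebra R) (I : finType) (e : I -> A).
Variable B : I -> algebra R.
Hypothesis eC : forall i x, GRing.comm (e i) x.
Hypothesis eM : forall i j, e i * e j = if i == j then e i else 0.
Hypothesis e1 : \sum_i e i = 1.
Variable f : forall i, corner (e i) -> B i.
Variable h : forall i, B i -> corner (e i).
Hypothesis f_hom : forall i, @alg_hom R (corner_ops (e i)) (ops (B i)) (@f i).
Hypotheses (fK : forall i, cancel (@f i) (@h i)) (hK : forall i, cancel (@h i) (@f i)).

(** [F] and [H] are the general forms of [psi_sum] and [phi_sum]. *)
Let F (x : A) : prod_alg B := fun i => @f i (corner_in (e i) x).
Let H (M : prod_alg B) : A := \sum_i val (@h i (M i)).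

Let ee i : e i * e i = e i. Proof. by rewrite eM eqxx. Qed.

Lemma peirce_hom : @alg_hom R (ops A) (ops (prod_alg B)) F.
Proof.
have fi i := corner_in_hom (f_hom i) (eC i) (ee i).
split; first split=> [x y|a x].
- by apply: functional_extensionality_dep => i; have [[+ _] _ _] := fi i; apply.
- by apply: functional_extensionality_dep => i; have [[_ +] _ _] := fi i; apply.
- by move=> x y; apply: functional_extensionality_dep => i; have [_ + _] := fi i; apply.
- by apply: functional_extensionality_dep => i; have [_ _] := fi i.
Qed.

Lemma peirceK : cancel F H.
Proof.
move=> x; rewrite /H /F; under eq_bigr do rewrite fK /=.
by rewrite -mulr_suml e1 mul1r.
Qed.

Lemma peirceVK : cancel H F.
Proof.
move=> M; apply: functional_extensionality_dep => i; rewrite /F -[RHS]hK.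
congr (@f i); apply: val_inj; rewrite /= /H mulr_sumr (bigD1 i) //= big1.
  by rewrite addr0 corner_unitl.
(* The [j]-th summand lies in the corner of [e j], which [e i] annihilates. *)
move=> j ji; rewrite -[val (@h j _)](corner_unitl (ee j)) mulrA eM.
by rewrite eq_sym (negbTE ji) mul0r.
Qed.

End CompleteIdempotents.

Theorem theorem5p9 (F : realType) (d n : nat) (d_gt0 : (0 < d)%N) (n_gt0 : (0 < n)%N)
  (xi : d.-tuple F[i]) (xi_uniq : uniq xi) (xi_root : all d.-unity_root xi)
  (xi_1 : xi`_0 = 1)
  (pi : forall mu : Comp d n, 'I_(mnum n mu) -> 'S_n)
  (pi_reps : forall mu : Comp d n, coset_reps (pi mu))
  (Psi : forall mu : Comp d n,
     corner (E_yh xi (pi mu)) -> mat_alg (hecke_mu F mu) (mnum n mu))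
  (Phi : forall mu : Comp d n,
     mat_alg (hecke_mu F mu) (mnum n mu) -> corner (E_yh xi (pi mu)))
  (Psi_def : forall mu, is_Psi (Psi mu))
  (Phi_def : forall mu, cancel (Psi mu) (Phi mu) /\ cancel (Phi mu) (Psi mu))
  (psi : forall mu : Comp d n,
     corner (E_ctl xi (pi mu)) -> mat_alg (tl_hecke F mu) (mnum n mu))
  (phi : forall mu : Comp d n,
     mat_alg (tl_hecke F mu) (mnum n mu) -> corner (E_ctl xi (pi mu)))
  (psi_def : forall mu, is_psi_bar (Psi mu) (psi mu))
  (phi_def : forall mu, is_phi_bar (Phi mu) (phi mu)) :
  (forall mu,
     [/\ @alg_iso (Lq F) (corner_ops (E_ctl xi (pi mu)))
           (ops (mat_alg (tl_hecke F mu) (mnum n mu))) (psi mu),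
         cancel (psi mu) (phi mu) & cancel (phi mu) (psi mu)])
  /\
  [/\ @alg_iso (Lq F) (ops (ctl F d n)) (ops (mats F d n)) (psi_sum psi),
      cancel (psi_sum psi) (phi_sum phi) & cancel (phi_sum phi) (psi_sum psi)].
Proof.
have P1_surj (mu : Comp d n) : forall M, exists N, @P1_mx F d n mu N = M.
  have P1S : forall y, exists x, @P1 F d n mu x = y.
    apply: tens_map_surj => [||y|y].
    - exact: quot_proj_hom.
    - by [].
    - exact: quot_proj_surj.
    - by exists y.
  (* A preimage of a matrix is chosen entry by entry. *)
  move=> M; have [N NP] := choice P1S.
  by exists (map_mx N M); apply/matrixP => i j; rewrite !mxE NP.
have Theta_surj (mu : Comp d n) : forall y, exists x, @Theta F d n xi mu (pi mu) x = y.
  move=> y; have /asboolP[a ya] := valP y; have [b ab] := quot_proj_surj a.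
  exists (corner_in _ b); apply: val_inj; rewrite ya -ab; exact: quot_projM.
have psiK mu : cancel (psi mu) (phi mu).
  (* On [Theta x] the composite is [Theta (Phi (Psi x))]; the other order is symmetric, with [P1_mx]
     in place of [Theta]. *)
  move=> y; have [x <-] := Theta_surj mu y.
  have [_ psiT] := psi_def mu; have [_ phiP] := phi_def mu; have [PsiK _] := Phi_def mu.
  by rewrite [psi mu _]psiT [phi mu _]phiP /= PsiK.
have phiK mu : cancel (phi mu) (psi mu).
  move=> M; have [N <-] := P1_surj mu M.
  have [_ psiT] := psi_def mu; have [_ phiP] := phi_def mu; have [_ PhiK] := Phi_def mu.
  by rewrite [phi mu _]phiP [psi mu _]psiT /= PhiK.
have psi_hom mu := proj1 (psi_def mu).
split.
  by move=> mu; split=> //; split=> //; exists (phi mu).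
pose e mu : ctl F d n := E_ctl xi (pi mu).
(* The summand units are images of the [E_sum], so centrality, orthogonality and completeness
   descend from the Yokonuma-Hecke algebra. *)
have eE : e = fun mu =>
    quot_proj (@ctl_rel F d n : _ -> Prop) (E_sum xi (@yh_t F d n) mu).
  by apply: functional_extensionality_dep => mu; congr quot_proj; exact: E_yhE.
have eC mu x : GRing.comm (e mu) x.
  rewrite eE; apply: quot_proj_central; exact: E_sum_central.
have eM mu nu : e mu * e nu = if mu == nu then e mu else 0.
  rewrite eE; apply: quot_proj_orth.
  exact: (E_sumM d_gt0 xi_uniq xi_root (@yh_t_expr F d n) (@yh_tC F d n)).
have e1 : \sum_mu e mu = 1.
  rewrite eE; apply: quot_proj_complete; exact: sum_E_sum.
have sumK := peirceK e1 psiK.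
have sumVK := peirceVK eM phiK.
split=> //; split; first exact: (peirce_hom eC eM psi_hom).
by exists (phi_sum phi).
Qed.
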